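(* Let $\mu$ be a probability distribution on $\mathbb N=\{0,1,2,\ldots\}$ with $|\mu|_1<1$ and with $\sum_{c\ge0}e^{tc}\mu(c)=\infty$ for all $t>0$. For $n\in\mathbb N$ such that a Bienaymé tree with offspring distribution $\mu$ has size $n$ with positive probability, let $T_n$ be a Bienaymé tree with offspring distribution $\mu$ conditioned to have size $n$, and let $V_n$ be a uniformly random node of $T_n$. Then, as $n\to\infty$ (along such $n$), $$\frac{\mathrm{wid}(T_n)}{n^{1/2}}\to\infty,\qquad \frac{|V_n|}{n^{1/2}}\to 0,\qquad \frac{\mathrm{ht}(T_n)}{n^{1/2}\log^3 n}\to 0,$$ where each of these convergences holds both in probability and in expectation.
   Context: A plane tree is a finite rooted tree in which the children of each node are ordered from left to right. A Bienaymé tree with offspring distribution $\mu$ is the family tree $T$ of a branching (Galton–Watson) process started from one individual with offspring distribution $\mu$. If $\mathbf P\{T \text{ has } n \text{ vertices}\}>0$, the Bienaymé tree conditioned to have size $n$ is the random plane tree $T_n$ with $\mathbf P\{T_n=t\}=\mathbf P\{T=t\mid T\text{ has } n\text{ vertices}\}$ for every plane tree $t$ with $n$ vertices. For $p>0$, $|\mu|_p=\left(\sum_{c\ge0}c^p\mu(c)\right)^{1/p}$, where $\mu(c)=\mu(\{c\})$. The height $|v|$ of a node $v$ is its graph distance to the root; $\mathrm{ht}(t)=\max_{v}|v|$; $\mathrm{wid}(t)=\max_{k\ge0}|\{v\in t:|v|=k\}|$. For random variables $X_n\ge 0$, ''$X_n\to 0$ (resp. $\infty$) in expectation'' means $\mathbf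 E[X_n]\to0$ (resp. $\infty$); ''$X_n\to\infty$ in probability'' means $\mathbf P\{X_n\ge K\}\to1$ for every $K$. *)

(* Defs.v *)
From HB Require Import structures.
From mathcomp Require Import all_boot all_order all_algebra finmap.
From mathcomp Require Import all_classical all_reals all_analysis.
Set Implicit Arguments.
Unset Strict Implicit.
Unset Printing Implicit Defensive.
Import Order.TTheory GRing.Theory Num.Theory.
Import numFieldNormedType.Exports.
Local Open Scope classical_set_scope.
Local Open Scope ring_scope.

(* Ulam-Harris words: the root is [::], and the children of u are, from left
   to right, rcons u 0, rcons u 1, ...; the graph distance from u to the root
   is size u. *)
Notation node := (seq nat).

Definition ulam_harris (t : {fset node}) : Prop :=
  [/\ [::] \in t,
      forall u i, rcons u i \in t -> u \in t &
      forall u i j, (i < j)%N -> rcons u j \in t -> rcons u i \in t].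

Record plane_tree :=
  PlaneTree { nodes :> {fset node}; _ : `[< ulam_harris nodes >] }.
HB.instance Definition _ := [isSub for nodes].
HB.instance Definition _ := [Countable of plane_tree by <:].

Definition height (t : plane_tree) : nat := \max_(v <- nodes t) size v.

Definition level (t : plane_tree) (k : nat) : {fset node} :=
  [fset v in nodes t | size v == k]%fset.

(* Levels beyond the height are empty. *)
Definition width (t : plane_tree) : nat :=
  \max_(k < (height t).+1) #|` level t k|.

(* Total progeny in Ulam-Harris encoding when w has b w children; this set may
   be infinite. *)
Definition family_tree (b : node -> nat) : set node :=
  [set u | forall w i, prefix (rcons w i) u -> (i < b w)%N].

Definition moment_norm {R : realType} (mu : probability nat R) (p : R) : \bar R :=
  ((\sum_(0 <= c <oo) (c%:R `^ p)%:E * mu [set c]) `^ p^-1)%E.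

Section Bienayme.
Context {R : realType} {d : measure_display} {Omega : measurableType d}.
Variables (P : probability Omega R) (xi : node -> {RV P >-> nat}).

Definition iid_offspring (mu : probability nat R) : Prop :=
  (forall u (A : set nat), P (xi u @^-1` A) = mu A) /\
  (forall (J : {fset node}) (A : node -> set nat),
    P (\bigcap_(u in [set` J]) (xi u @^-1` A u)) =
    (\prod_(u <- J) P (xi u @^-1` A u))%E).

Definition bienayme_tree (w : Omega) : set node := family_tree (xi ^~ w).

Definition bienayme_size (n : nat) : set Omega :=
  [set w | (bienayme_tree w #= `I_n)%card].

Definition cond_prob (A B : set Omega) : R := fine (P (A `&` B)) / fine (P B).

Definition conditioned_law (n : nat) (t : plane_tree) : R :=
  cond_prob [set w | bienayme_tree w = [set` nodes t]] (bienayme_size n).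

End Bienayme.

Section RandomTree.
Context {R : realType} {d : measure_display} {Omega : measurableType d}.
Variables (P : probability Omega R).
Variables (T : Omega -> plane_tree) (V : Omega -> node).

(* There are countably many pairs (t, v), so these events generate the discrete
   sigma-algebra. *)
Definition measurable_tree_node : Prop :=
  forall t v, measurable [set w | T w = t /\ V w = v].

Definition has_conditioned_law (n : nat) (q : plane_tree -> R) : Prop :=
  forall t, #|` nodes t| = n -> P [set w | T w = t] = (q t)%:E.

(* Conditionally on T = t, V is uniform on the nodes of t. *)
Definition uniform_node : Prop :=
  forall t v, v \in nodes t ->
    P [set w | T w = t /\ V w = v] =
    (P [set w | T w = t] * (#|` nodes t|%:R^-1)%:E)%E.

End RandomTree.

(* Each X n may live on its own probability space. *)
Section Convergence.
Context {R : realType} {d : nat -> measure_display}.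
Context {Omega : forall n, measurableType (d n)}.
Variables (F : set_system nat) (P : forall n, probability (Omega n) R).
Variable X : forall n, Omega n -> R.

Definition to_infty_in_probability : Prop :=
  forall K : R, P n [set w | K <= @X n w] @[n --> F] --> 1%E.

Definition to_zero_in_probability : Prop :=
  forall e : R, 0 < e -> P n [set w | e < `|@X n w|] @[n --> F] --> 0%E.

Definition to_infty_in_expectation : Prop :=
  ('E_(P n)[@X n])%E @[n --> F] --> +oo%E.

Definition to_zero_in_expectation : Prop :=
  ('E_(P n)[@X n])%E @[n --> F] --> 0%E.

End Convergence.

(* Main.v *)
Require Import Defs.
From HB Require Import structures.
From mathcomp Require Import fingroup perm.
From mathcomp Require Import all_boot all_order all_algebra finmap.
From mathcomp Require Import all_classical all_reals all_analysis.
From mathcomp Require Import measurable_realfun.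
From mathcomp Require Import ring lra zify.
Set Implicit Arguments.
Unset Strict Implicit.
Unset Printing Implicit Defensive.
Import Order.TTheory GRing.Theory Num.Theory.
Import numFieldNormedType.Exports.
Local Open Scope classical_set_scope.
Local Open Scope ring_scope.

(** Let [f] be the mass function of the offspring distribution, let
    [X_1, X_2, ...] be independent of law [f], and let [S_n] be the sum of the
    first [n] of them.  The proof rests on the identity
      [E[#{v in T : |v| >= h}; |T| = n] = E[X_1 ... X_h; S_n = n - 1]]
    ([trees_deep]), whose case [h = 0] is the cycle lemma
    [n P(|T| = n) = P(S_n = n - 1)] ([trees_total]).  Together they say that
      [P(|V_n| >= h) = E[X_1 ... X_h | S_n = n - 1]].
    Both are obtained by exploring the tree node by node: the sums over the trees
    that extend a partially explored tree satisfy the same recursion as the right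
    hand sides.

    Given their unordered values, [X_1, ..., X_n] are in uniformly random order, so
    by Maclaurin's inequality the mean of a product of [h] of them is at most the
    [h]-th power of their average ([exchangeable_prod_le]), which is less than 1 on
    the event [S_n = n - 1].  If the values above [K] have sum at least [b n], a
    second use of the inequality improves the bound.  Let [h = 2 a].  An excess
    [E = X_1 + ... + X_a - a] lowers the average of the remaining variables, so the
    next [a] factors contribute at most [exp(- a E / n)]; this discounts each of
    the first [a] factors [x] by [exp(- a (x - 1) / n)], and the average of the
    discounted values is at most [1 - b (1 - exp(- a K / n))].  The outcome is the
    bound [exp(- a b (1 - exp(- a K / n)))] ([spine_weight_half]).

    Because the mean [m] of [f] is less than 1, the values up to [K] have sum at
    most about [(1 - b) n] with [b = (1 - m) / 3], except with exponentially small
    probability ([spine_weight_tail]); so on the event [S_n = n - 1] the values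
    above [K] usually have sum at least [b n].  The absence of exponential moments
    is what makes this survive the conditioning: [P(S_n = n - 1)], when it is
    positive, decays more slowly than any exponential, since the missing amount can
    be made up by few values [c] with [f(c) >= exp(- e c)]
    ([spine_weight_subexp]).  As [K] is arbitrary, for every [M] and all large [n],
      [P(|V_n| >= 2 a) <= exp(- M a^2 / n) + 2 / n^3]
    ([depth_tail]).

    Summation over [a] gives [E |V_n| = o(sqrt n)].  A union bound with [a] close to
    [sqrt n * ln n] gives [E ht(T_n) = O(sqrt n * ln n)].  Finally, with high
    probability at least half of the nodes are below height [e sqrt n], and then
    some level contains of the order of [sqrt n / e] of them. *)

(** * Maclaurin's inequality for exchangeable products *)

(** Convexity of the [k]-th power: its graph lies above the tangent at [y]. *)
Lemma expr_tangent (R : realFieldType) (x y : R) k : 0 <= x -> 0 <= y ->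
  y ^+ k + k%:R * y ^+ k.-1 * (x - y) <= x ^+ k.
Proof.
move=> x0 y0; case: k => [|k] /=; first by rewrite !expr0 !mul0r addr0.
elim: k => [|k IH]; first by rewrite !expr1 expr0 !mul1r addrC subrK.
rewrite [leRHS]exprS; apply: le_trans (ler_wpM2l x0 IH); rewrite -subr_ge0.
have -> : x * (y ^+ k.+1 + k.+1%:R * y ^+ k * (x - y)) -
  (y ^+ k.+2 + k.+2%:R * y ^+ k.+1 * (x - y)) = 
  k.+1%:R * y ^+ k * (x - y) ^+ 2.
  by rewrite !exprS -(natr1 k.+1); ring.
by rewrite mulr_ge0 ?sqr_ge0// mulr_ge0// exprn_ge0.
Qed.

(** The coefficient of degree [k] in the product of the [1 + x X] is the [k]-th
    elementary symmetric polynomial [e_k] of [v].  By induction on [v]: with [A]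
    the mean of the tail, adding an entry [x] gives at most
    ['C(m, k+1) A^(k+1) + x 'C(m, k) A^k], and this is the value at the new mean
    of the tangent at [A] to ['C(m+1, k+1) y^(k+1)]. *)
Lemma maclaurin (R : realFieldType) (v : seq R) k : all (fun x => 0 <= x) v ->
  (\prod_(x <- v) (1 + x *: 'X))`_k <=
  'C(size v, k)%:R * ((\sum_(x <- v) x) / (size v)%:R) ^+ k.
Proof.
elim: v k => [|x s IH] k.
  move=> _; rewrite !big_nil mul0r coef1 /=; case: k => [|k].
    by rewrite expr0 mulr1.
  by rewrite bin0n mul0r.
case/andP=> x0 s0.
have S0 : 0 <= \sum_(x <- s) x.
  by rewrite big_seq sumr_ge0 // => y ys; exact: (allP s0).
rewrite !big_cons; set S := \sum_(x <- s) x in S0 IH *.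
set e := \prod_(x <- s) _ in IH *.
set m := size s in IH *; set A := S / m%:R in IH.
have A0 : 0 <= A by rewrite divr_ge0.
have mA : m%:R * A = S.
  have [m0|m0] := eqVneq m 0%N; last by rewrite mulrC divfK// pnatr_eq0.
  by rewrite m0 mul0r /S (size0nil m0) big_nil.
rewrite mulrDl mul1r -scalerAl coefD coefZ coefXM /=.
case: k => [|k] /=; first by rewrite mulr0 addr0 (le_trans (IH _ s0))// !bin0 !expr0.
set y := (x + S) / (size (x :: s))%:R.
have y0 : 0 <= y by rewrite divr_ge0// addr_ge0.
apply: le_trans (_ : 'C(m, k.+1)%:R * A ^+ k.+1 + x * ('C(m, k)%:R * A ^+ k) <= _).
  by rewrite lerD ?IH// ler_wpM2l// IH.
have := ler_wpM2l (ler0n R 'C(m.+1, k.+1)) (expr_tangent k.+1 y0 A0).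
apply: le_trans; rewrite /= -/m.
have yA : y - A = (x - A) / m.+1%:R.
  have m1 : (m.+1%:R : R) != 0 by rewrite pnatr_eq0.
  apply: (mulIf m1); rewrite divfK// mulrBl divfK// -mA -natr1; ring.
have Cb : 'C(m.+1, k.+1)%:R * (k.+1%:R / m.+1%:R) = 'C(m, k)%:R :> R.
  by rewrite mulrA -natrM mulnC -mul_bin_diag mulnC natrM mulfK// pnatr_eq0.
rewrite yA.
have -> : 'C(m.+1, k.+1)%:R * (A ^+ k.+1 + k.+1%:R * A ^+ k * ((x - A) / m.+1%:R)) =
  'C(m.+1, k.+1)%:R * A ^+ k.+1 + ('C(m.+1, k.+1)%:R * (k.+1%:R / m.+1%:R)) * A ^+ k * (x - A) by ring.
rewrite Cb binS natrD exprS le_eqVlt; apply/orP; left; apply/eqP; ring.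
Qed.

Lemma elementary_symmetric_le (R : realFieldType) (I : finType) (D : {set I}) (v : I -> R) k :
  (forall i, 0 <= v i) ->
  \sum_(A : {set I} | (A \subset D) && (#|A| == k)) \prod_(i in A) v i <=
  'C(#|D|, k)%:R * ((\sum_(i in D) v i) / #|D|%:R) ^+ k.
Proof.
move=> v0; have := @maclaurin R [seq v i | i <- enum D] k.
rewrite size_map -cardE !big_map !big_enum/= => H; apply: le_trans (H _); last first.
  by apply/allP => x /mapP[i _ ->].
rewrite le_eqVlt; apply/orP; left; apply/eqP.
pose F i : {poly R} := if i \in D then v i *: 'X else 0.
have -> : \prod_(i in D) (1 + v i *: 'X) = \prod_i (F i + 1) :> {poly R}.
  rewrite big_mkcond; apply: eq_bigr => i _; rewrite /F; case: ifP => _.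
    by rewrite addrC.
  by rewrite add0r.
rewrite bigA_distr coef_sum big_mkcond; apply: eq_bigr => J _.
have -> : \prod_i (if i \in J then F i else 1) = \prod_(i in J) F i.
  by rewrite [RHS]big_mkcond.
have [JD|JD] /= := boolP (J \subset D).
  rewrite (eq_bigr (fun i => v i *: 'X)); last first.
    by move=> i iJ; rewrite /F (fintype.subsetP JD _ iJ).
  rewrite scaler_prod coefZ prodr_const coefXn eq_sym.
  by case: eqP; rewrite ?mulr1 ?mulr0.
have [i iJ iD] := fintype.subsetPn JD.
by rewrite (bigD1 i iJ)/= /F (negbTE iD) mul0r coef0.
Qed.

(** If the weight [phi] of [d] is invariant under exchanging coordinates in [D],
    then a product over a subset of [D] has the same mean as for any other subset
    of the same size, hence the mean of a normalised elementary symmetric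
    polynomial; Maclaurin's inequality bounds the latter pointwise. *)
Section Exchangeable.
Variables (R : realFieldType) (I J : finType) (D : {set I}).
Variables (phi : {ffun I -> J} -> R) (v : J -> R).
Hypothesis phi_ge0 : forall d, 0 <= phi d.
Hypothesis v_ge0 : forall x, 0 <= v x.
Hypothesis phi_sym : forall (d : {ffun I -> J}) x y, x \in D -> y \in D ->
  phi [ffun i => d (tperm x y i)] = phi d.

Let Q (A : {set I}) := \sum_d phi d * \prod_(i in A) v (d i).

Let Q_tperm (A : {set I}) x y : x \in D -> y \in D -> x \in A -> y \notin A ->
  Q (y |: A :\ x) = Q A.
Proof.
move=> xD yD xA yA; pose s := tperm x y.
pose act (d : {ffun I -> J}) := [ffun i => d (s i)].
have actK : involutive act.
  by move=> d; apply/ffunP => i; rewrite !ffunE tpermK.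
rewrite /Q [RHS](reindex_inj (inv_inj actK)); apply: eq_bigr => d _.
rewrite phi_sym//; congr (_ * _).
rewrite (reindex_inj (inv_inj (tpermK x y))) /=.
apply: eq_big => [i|i _]; last by rewrite ffunE.
rewrite !inE; case: tpermP => [->|->|/eqP nx /eqP ny].
- by rewrite eqxx xA.
- by rewrite eqxx /= orbF (negbTE yA); apply: contraNF yA => /eqP <-.
by rewrite (negbTE nx) (negbTE ny).
Qed.

(* Two subsets of [D] of equal size are linked by a chain of transpositions, each
   replacing one element outside [B] by one element of [B]. *)
Let Q_card (A B : {set I}) : A \subset D -> B \subset D -> #|A| = #|B| -> Q A = Q B.
Proof.
move=> + BD; have [m] := ubnP #|A :\: B|; elim: m A => // m IH A + AD cAB.
have [AB|] := boolP (A \subset B).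
  by rewrite (_ : A = B)//; apply/eqP; rewrite eqEcard AB cAB leqnn.
case/fintype.subsetPn => x xA xB.
have /fintype.subsetPn[y yB yA] : ~~ (B \subset A).
  apply: contraL xA => BA; have /eqP <- : B == A by rewrite eqEcard BA cAB leqnn.
  by [].
have xy : x != y by apply: contraNneq xB => ->.
move=> lem; rewrite -(@Q_tperm A x y (fintype.subsetP AD x xA) (fintype.subsetP BD y yB))//.
apply: IH.
- rewrite -ltnS; apply: leq_trans lem; rewrite ltnS; apply: proper_card.
  apply/fintype.properP; split; last first.
    exists x.
    + by rewrite !inE xA xB.
    + by rewrite !inE eqxx (negbTE xy) andbF.
  apply/fintype.subsetP => i; rewrite !inE; case/andP => iB /orP[/eqP iy|/andP[_ iA]].
    by move: iB; rewrite iy yB.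
  by rewrite iB iA.
- apply/fintype.subsetP => i; rewrite !inE => /orP[/eqP ->|/andP[_ iA]].
    exact: (fintype.subsetP BD).
  exact: (fintype.subsetP AD).
- by rewrite cardsU1 !inE (negbTE yA) andbF /= -cAB (cardsD1 x A) xA.
Qed.

Lemma exchangeable_prod_le (A : {set I}) : A \subset D ->
  \sum_d phi d * \prod_(i in A) v (d i) <=
  \sum_d phi d * ((\sum_(i in D) v (d i)) / #|D|%:R) ^+ #|A|.
Proof.
move=> AD; set k := #|A|.
have C0 : 0 < 'C(#|D|, k)%:R :> R by rewrite ltr0n bin_gt0 subset_leq_card.
rewrite -(ler_pM2l C0) -/(Q A).
have -> : 'C(#|D|, k)%:R * Q A =
    \sum_(B : {set I} | (B \subset D) && (#|B| == k)) Q B.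
  rewrite (eq_bigr (fun=> Q A)); last first.
    by move=> B /andP[BD /eqP kB]; exact: Q_card.
  rewrite sumr_const -cards_draws mulr_natl cardsE; congr (_ *+ _).
rewrite /Q exchange_big mulr_sumr ler_sum// => d _.
rewrite -mulr_sumr mulrCA ler_wpM2l//.
exact: elementary_symmetric_le.
Qed.

End Exchangeable.

(** * The random walk with a spine *)
Definition below n a : {set 'I_n} := [set i : 'I_n | (i < a)%N]%SET.

Lemma card_below n a : (a <= n)%N -> #|below n a| = a.
Proof.
move=> an; rewrite -sum1_card (eq_bigl (fun i : 'I_n => (i < a)%N)).
  by rewrite (big_ord_narrow an) sum1_card card_ord.
by move=> i; rewrite inE.
Qed.

Section Walk.
Variables (R : realType) (f : nat -> R).
Hypothesis f_ge0 : forall c, 0 <= f c.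

Definition step_poly N : {poly R} := \poly_(c < N) f c.

(** Let [X_1, ..., X_n] be independent of law [f] and let [S_n] be their sum.
    Since ['X * p^`()] is the generating function of [c f(c)], this number is
    [E[X_1 ... X_h; S_n = n - j]] when [h <= n], [j <= n] and [n - j < N].
    In particular [spine_weight n 0 n 1] is [P(S_n = n - 1)] when [0 < n]. *)
Definition spine_weight N h n j : R :=
  if (j <= n)%N then
    (('X * (step_poly N)^`()) ^+ h * step_poly N ^+ (n - h))`_(n - j) else 0.

(** Expanding the product turns a coefficient into a sum over the possible values
    [d] of [(X_1, ..., X_n)], where symmetry arguments apply. *)
Lemma coef_prod_poly n N (a : 'I_n -> nat -> R) s :
  (\prod_(i < n) \poly_(c < N) a i c)`_s =
  \sum_(d : {ffun 'I_n -> 'I_N} | (\sum_i d i == s)%N) \prod_i a i (d i).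
Proof.
under eq_bigr do rewrite poly_def.
rewrite bigA_distr_bigA/= coef_sum [RHS]big_mkcond; apply: eq_bigr => d _.
rewrite scaler_prod coefZ.
have -> : \prod_(i < n) 'X^(d i) = 'X^(\sum_i d i) :> {poly R} by rewrite expr_sum.
by rewrite coefXn eq_sym; case: eqP; rewrite ?mulr1 ?mulr0.
Qed.

Lemma mulX_deriv_step N : 'X * (step_poly N)^`() = \poly_(c < N) (c%:R * f c).
Proof.
apply/polyP => i; rewrite coefXM coef_deriv !coef_poly; case: i => [|i] /=.
  by rewrite mul0r if_same.
by case: ifP => _; rewrite ?mul0rn// mulr_natl.
Qed.

Lemma spine_weight_sum N h n j : (h <= n)%N -> (j <= n)%N ->
  spine_weight N h n j =
  \sum_(d : {ffun 'I_n -> 'I_N} | (\sum_i d i == n - j)%N)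
    (\prod_i f (d i)) * \prod_(i in below n h) (d i)%:R.
Proof.
move=> hn jn; rewrite /spine_weight jn mulX_deriv_step.
pose a (i : 'I_n) c := (if (i < h)%N then c%:R else 1) * f c.
rewrite (_ : _ * _ = \prod_(i < n) \poly_(c < N) a i c).
  rewrite coef_prod_poly; apply: eq_bigr => d _.
  rewrite /a big_split /= mulrC; congr (_ * _).
  by rewrite [RHS]big_mkcond; apply: eq_bigr => i _; rewrite inE.
rewrite (bigID (fun i : 'I_n => (i < h)%N)) /=; congr (_ * _).
  rewrite (eq_bigr (fun=> \poly_(c < N) (c%:R * f c))).
    by rewrite (big_ord_narrow hn) prodr_const card_ord.
  by move=> i ih; apply/polyP => c; rewrite !coef_poly /a ih.
rewrite (eq_bigr (fun=> step_poly N)).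
  rewrite prodr_const; congr (_ ^+ _); rewrite -cardsE cardsCs card_ord.
  congr (_ - _)%N; rewrite -[LHS](card_below hn); apply: eq_card => i.
  by rewrite !inE negbK.
by move=> i ih; apply/polyP => c; rewrite !coef_poly /a (negbTE ih) mul1r.
Qed.


Lemma sum_tperm n (F : 'I_n -> R) (d : {ffun 'I_n -> 'I_n}) x y :
  \sum_i F ([ffun i => d (tperm x y i)] i) = \sum_i F (d i).
Proof.
rewrite [RHS](reindex_inj (@perm_inj _ (tperm x y))).
by apply: eq_bigr => i _; rewrite ffunE.
Qed.

Lemma prod_tperm n (F : 'I_n -> R) (d : {ffun 'I_n -> 'I_n}) x y :
  \prod_i F ([ffun i => d (tperm x y i)] i) = \prod_i F (d i).
Proof.
rewrite [RHS](reindex_inj (@perm_inj _ (tperm x y))).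
by apply: eq_bigr => i _; rewrite ffunE.
Qed.

(** * Bounding the spine weight when large values carry much mass *)

(** A vector [d] of values is heavy if its entries above [K] sum to at least
    [b n].  On the event [S_n = n - 1] the product of the first [2 a] entries of a
    heavy vector is small on average ([heavy_first_half], [heavy_second_half]),
    while light vectors are improbable ([light_chernoff]). *)
Section FixedSize.
Variables (n a K : nat) (b : R).
Hypothesis an : (2 * a <= n)%N.
Hypothesis n_gt0 : (0 < n)%N.
Hypothesis b_ge0 : 0 <= b.

Implicit Type d : {ffun 'I_n -> 'I_n}.

Definition heavy_mass d : R := \sum_i (if (K < d i)%N then (d i)%:R else 0).

Definition heavy d := b * n%:R <= heavy_mass d.

Definition total d : R := \sum_i (d i)%:R.

(* The probability of [d], restricted to sum [n - 1] and to heavy ([P := id]) or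
   light ([P := negb]) vectors. *)
Let phi (P : bool -> bool) d :=
  if (total d == n.-1%:R) && P (heavy d) then \prod_i f (d i) else 0.

Let phi_ge0 P d : 0 <= phi P d.
Proof. by rewrite /phi; case: ifP => // _; apply: prodr_ge0. Qed.

Let phi_sym P d x y : phi P [ffun i => d (tperm x y i)] = phi P d.
Proof.
rewrite /phi /heavy /total /heavy_mass.
rewrite (sum_tperm (fun k : 'I_n => k%:R)).
rewrite (sum_tperm (fun k : 'I_n => if (K < k)%N then k%:R else 0)).
by rewrite (prod_tperm (fun k : 'I_n => f k)).
Qed.

Let r := expR (- (a%:R * K%:R / n%:R)) : R.

(* The entry [x], with the gain of the first use of Maclaurin's inequality
   distributed over the first [a] entries. *)
Let discount (x : 'I_n) : R := x%:R * expR (- (a%:R * (x%:R - 1) / n%:R)).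

Let nR : 0 < n%:R :> R. Proof. by rewrite ltr0n. Qed.

(** The mean of the entries is below 1, so Maclaurin's inequality bounds the mean
    of any product of entries by 1. *)
Lemma light_prod_le : \sum_d phi negb d * \prod_(i in below n (2 * a)) (d i)%:R <=
  \sum_d phi negb d.
Proof.
have := exchangeable_prod_le (D := [set: 'I_n]%SET) (phi_ge0 negb)
  (fun x : 'I_n => ler0n R x) (fun d x y _ _ => phi_sym negb d x y)
  (finset.subsetT (below n (2 * a))).
move/le_trans; apply.
apply: ler_sum => d _; rewrite /phi; case: ifP => [/andP[/eqP tot _]|]; last by rewrite mul0r.
rewrite ler_piMr ?prodr_ge0//; apply: exprn_ile1.
  by rewrite divr_ge0// sumr_ge0.
rewrite cardsT card_ord ler_pdivrMr// mul1r.
rewrite (_ : \sum_(i in _) _ = total d); last first.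
  by apply: eq_bigl => i; rewrite inE.
by rewrite tot ler_nat leq_pred.
Qed.

(** Given the first [a] entries, with sum [a + E], the other [n - a] entries have
    mean [1 - (1 + E) / (n - a)], at most [exp(- E / n)].  Maclaurin's inequality
    for the entries of rank [a, ..., 2 a - 1] thus gives the factor
    [exp(- a E / n)], which splits over the first [a] entries [x] as
    [exp(- a (x - 1) / n)]. *)
Lemma heavy_first_half : \sum_d phi id d * \prod_(i in below n (2 * a)) (d i)%:R <=
  \sum_d phi id d * \prod_(i in below n a) discount (d i).
Proof.
pose A := below n a; pose B := below n (2 * a) :\: A.
have a2 : (a <= 2 * a)%N by rewrite leq_pmull.
have an' := leq_trans a2 an.
have sAB : A \subset below n (2 * a).
  by apply/fintype.subsetP => i; rewrite !inE => /leq_trans; apply.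
have cA : #|A| = a by rewrite card_below.
have cB : #|B| = a.
  by rewrite cardsD (finset.setIidPr sAB) cA card_below// mul2n -addnn addnK.
have cD : #|~: A| = (n - a)%N by rewrite [LHS]cardsCs card_ord finset.setCK cA.
rewrite (eq_bigr (fun d => (phi id d * \prod_(i in A) (d i)%:R) * \prod_(i in B) (d i)%:R)); last first.
  move=> d _; rewrite -mulrA; congr (_ * _).
  by rewrite (finset.big_setID A)/= (finset.setIidPr sAB).
have BD : B \subset ~: A.
  by apply/fintype.subsetP => i; rewrite !inE => /andP[].
have := @exchangeable_prod_le R _ _ (~: A)
  (fun d => phi id d * \prod_(i in A) (d i)%:R) _ _ (fun x : 'I_n => ler0n R x) _ B BD.
move=> /(_ _ _)/le_trans; apply.
- by move=> d; rewrite mulr_ge0 ?phi_ge0// prodr_ge0.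
- move=> d x y; rewrite !inE => xA yA; rewrite phi_sym; congr (_ * _).
  apply: eq_bigr => i; rewrite inE => iA; rewrite ffunE tpermD//.
    by apply: contraNneq xA => ->.
  by apply: contraNneq yA => ->.
apply: ler_sum => d _; rewrite -mulrA /phi.
case: ifP => [/andP[/eqP tot _]|]; last by rewrite !mul0r.
rewrite ler_wpM2l ?prodr_ge0// cB cD.
(* If one of the first [a] entries vanishes then so do both products; otherwise
   [E >= 0], which allows replacing [n - a] by [n]. *)
have [/existsP[i /andP[iA /eqP di0]]|] := boolP [exists i, (i \in A) && (d i == 0%N :> nat)].
  by rewrite (bigD1 i iA) (bigD1 (P := mem A) i iA)/= /discount di0 !mul0r.
rewrite negb_exists => /forallP dpos.
have d1 i : i \in A -> 1 <= (d i)%:R :> R.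
  by move=> iA; have := dpos i; rewrite iA /= -lt0n ler1n.
rewrite big_split /= ler_wpM2l ?prodr_ge0//.
pose E := \sum_(i in A) ((d i)%:R - 1) : R.
have E0 : 0 <= E by apply: sumr_ge0 => i iA; rewrite subr_ge0 d1.
have -> : \prod_(i in A) expR (- (a%:R * ((d i)%:R - 1) / n%:R)) = expR (- (E / n%:R)) ^+ a.
  rewrite -expRM_natl -expR_sum; congr expR.
  by rewrite sumrN -mulr_suml -mulr_sumr mulrN mulrA.
have na : 0 < (n - a)%:R :> R by rewrite ltr0n subn_gt0; lia.
have sumD : \sum_(i in ~: A) (d i)%:R = (n - a)%:R - 1 - E.
  have : total d = \sum_(i in A) (d i)%:R + \sum_(i in ~: A) (d i)%:R.
    rewrite /total (bigID (mem A)) /=; congr (_ + _).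
    by apply: eq_bigl => i; rewrite finset.in_setC.
  have -> : \sum_(i in A) (d i)%:R = a%:R + E.
    by rewrite /E sumrB sumr_const cA addrC subrK.
  rewrite tot -subn1 !natrB//; lra.
rewrite lerXn2r// ?nnegrE ?expR_ge0//.
  by rewrite divr_ge0// sumr_ge0.
apply: le_trans (expR_ge1Dx _); rewrite sumD.
rewrite ler_pdivrMr// mulrDl mul1r -addrA lerD2l mulNr -opprD lerN2.
apply: le_trans (_ : E <= _); last by rewrite lerDr.
rewrite mulrAC ler_pdivrMr// ler_wpM2l// ler_nat; exact: leq_subr.
Qed.

(** Maclaurin's inequality for the discounted entries: every entry above [K] loses
    the proportion [1 - r], so the mean of the discounted entries of a heavy
    vector is at most [1 - b (1 - r)]. *)
Lemma heavy_second_half : \sum_d phi id d * \prod_(i in below n a) discount (d i) <=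
  (\sum_d phi id d) * expR (- (a%:R * (b * (1 - r)))).
Proof.
have v0 x : 0 <= discount x by rewrite mulr_ge0 ?expR_ge0.
have := exchangeable_prod_le (D := [set: 'I_n]%SET) (phi_ge0 id) v0
  (fun d x y _ _ => phi_sym id d x y) (finset.subsetT (below n a)).
move/le_trans; apply.
rewrite mulr_suml; apply: ler_sum => d _; rewrite  /phi.
case: ifP => [/andP[/eqP tot hd]|]; last by rewrite !mul0r.
rewrite ler_wpM2l ?prodr_ge0// cardsT card_ord card_below; last by lia.
rewrite -mulrN expRM_natl lerXn2r// ?nnegrE ?expR_ge0//.
  by rewrite divr_ge0 ?sumr_ge0// => i _; rewrite mulr_ge0 ?expR_ge0.
apply: le_trans (expR_ge1Dx _); rewrite ler_pdivrMr//.
have r1 : 0 <= 1 - r.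
  by rewrite subr_ge0 expR_le1 oppr_le0 divr_ge0// mulr_ge0.
apply: le_trans (_ : total d - (1 - r) * heavy_mass d <= _); last first.
  rewrite tot [leRHS]mulrDl mul1r lerD//; first by rewrite ler_nat leq_pred.
  by rewrite mulNr lerN2 (mulrC b) -mulrA ler_wpM2l.
rewrite /total /heavy_mass mulr_sumr -sumrB (eq_bigl predT); last by move=> i; rewrite inE.
apply: ler_sum => i _; rewrite /discount; have [Kd|dK] := ltnP K (d i).
  have -> : (d i)%:R - (1 - r) * (d i)%:R = (d i)%:R * r :> R by ring.
  rewrite ler_wpM2l//.
  rewrite ler_expR lerN2 ler_pM2r ?invr_gt0// ler_wpM2l//.
  by rewrite lerBrDr natr1 ler_nat.
rewrite mulr0 subr0; have [->|d0] := posnP (d i); first by rewrite mul0r.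
rewrite ler_piMr// expR_le1 oppr_le0 divr_ge0// mulr_ge0//.
by rewrite subr_ge0 ler1n.
Qed.

(** Chernoff's bound: for a light vector with sum [n - 1] the entries up to [K]
    sum to more than [n - 1 - b n]. *)
Lemma light_chernoff (t : R) : 0 <= t -> \sum_d phi negb d <=
  expR t * (expR (- (t * (1 - b))) *
    \sum_(c < n) f c * expR (t * (if (K < c)%N then 0 else c%:R))) ^+ n.
Proof.
move=> t0; pose light (c : nat) : R := if (K < c)%N then 0 else c%:R.
have -> : expR t * (expR (- (t * (1 - b))) * \sum_(c < n) f c * expR (t * light c)) ^+ n =
  \sum_(d : {ffun 'I_n -> 'I_n}) (\prod_i f (d i)) * expR (t * (\sum_i light (d i) - (n%:R - 1 - b * n%:R))).
  rewrite exprMn -expRM_natl mulrA -expRD.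
  rewrite (_ : _ ^+ n = \prod_(i < n) \sum_(c < n) f c * expR (t * light c)); last first.
    by rewrite prodr_const card_ord.
  rewrite bigA_distr_bigA mulr_sumr; apply: eq_bigr => d _ /=.
  rewrite big_split /= mulrCA -expR_sum -expRD; congr (_ * expR _).
  by rewrite -mulr_sumr; ring.
apply: ler_sum => d _; rewrite /phi; case: ifP => [/andP[/eqP tot hd]|_]; last first.
  by rewrite mulr_ge0 ?expR_ge0// prodr_ge0.
rewrite ler_peMr ?prodr_ge0//; rewrite -[leLHS]expR0 ler_expR mulr_ge0//.
have : total d = heavy_mass d + \sum_i light (d i).
  rewrite /total /heavy_mass -big_split /=; apply: eq_bigr => i _.
  by rewrite /light; case: ifP => _; rewrite ?addr0 ?add0r.
rewrite tot -subn1 natrB//; move: hd; rewrite /heavy -ltNge; lra.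
Qed.

Lemma spine_weight_phi h : (h <= n)%N -> spine_weight n h n 1 =
  \sum_d phi id d * \prod_(i in below n h) (d i)%:R +
  \sum_d phi negb d * \prod_(i in below n h) (d i)%:R.
Proof.
move=> hn; rewrite spine_weight_sum// -big_split/= big_mkcond; apply: eq_bigr => d _.
rewrite -mulrDl /phi (_ : (total d == _) = (\sum_i d i == n - 1)%N); last first.
  by rewrite /total -natr_sum eqr_nat subn1.
by case: ifP => _ //=; [case: (heavy d); rewrite /= ?addr0 ?add0r | rewrite addr0 mul0r].
Qed.

Lemma spine_weight_half (t : R) : 0 <= t ->
  spine_weight n (2 * a) n 1 <=
  spine_weight n 0 n 1 * expR (- (a%:R * (b * (1 - r)))) +
  expR t * (expR (- (t * (1 - b))) *
    \sum_(c < n) f c * expR (t * (if (K < c)%N then 0 else c%:R))) ^+ n.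
Proof.
move=> t0; rewrite spine_weight_phi//; apply: lerD.
  apply: le_trans heavy_first_half _; apply: le_trans heavy_second_half _.
  rewrite ler_wpM2r ?expR_ge0// spine_weight_phi//.
  rewrite -[leLHS]addr0 lerD//.
    by apply: ler_sum => d _; rewrite big1 ?mulr1// => i; rewrite inE ltn0.
  by apply: sumr_ge0 => d _; rewrite mulr_ge0// prodr_ge0.
by apply: le_trans light_prod_le (light_chernoff t0).
Qed.

End FixedSize.

Lemma expR_le_quadratic (x : R) : 0 <= x -> x <= 2^-1 -> expR x <= 1 + x + 2 * x ^+ 2.
Proof.
move=> x0 x1; have p : 0 < 1 - x by lra.
have : (expR x)^-1 >= 1 - x by rewrite -expRN; exact: expR_ge1Dx.
rewrite -[leLHS]invrK lef_pV2 ?posrE ?invr_gt0 ?expR_gt0// => /le_trans; apply.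
rewrite -[leLHS]div1r ler_pdivrMr//; nra.
Qed.

(** The exponential moment of order [t] of [X 1_(X <= K)] is at most
    [1 + t (1 + b) m] when [2 t K <= b], so that with [b = (1 - m) / 3] and
    [t = b / (2 K)] the light vectors contribute an exponentially small term. *)
Lemma spine_weight_tail (m : R) K n a :
  0 <= m -> m < 1 ->
  \sum_(c < n) f c <= 1 -> \sum_(c < n) c%:R * f c <= m ->
  (0 < K)%N -> (0 < n)%N -> (2 * a <= n)%N ->
  let b := (1 - m) / 3 in
  spine_weight n (2 * a) n 1 <=
  spine_weight n 0 n 1 * expR (- (a%:R * (b * (1 - expR (- (a%:R * K%:R / n%:R)))))) +
  expR (b / (2 * K%:R)) * expR (- (b ^+ 2 / (2 * K%:R))) ^+ n.
Proof.
move=> m0 m1 f1 fm K0 n0 an; set b := _ / 3 => /=.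
have KR : 1 <= K%:R :> R by rewrite ler1n.
have b0 : 0 < b by rewrite divr_gt0// subr_gt0.
have b3 : b <= 3^-1 by rewrite /b; lra.
pose t := b / (2 * K%:R).
have t0 : 0 < t by rewrite divr_gt0// mulr_gt0// ltr0n.
have tK : 2 * t * K%:R = b by rewrite /t; field; rewrite pnatr_eq0; lia.
apply: le_trans (@spine_weight_half n a K b an n0 (ltW b0) t (ltW t0)) _.
rewrite lerD2l ler_wpM2l ?expR_ge0// lerXn2r ?nnegrE ?expR_ge0//.
  by rewrite mulr_ge0 ?expR_ge0// sumr_ge0// => c _; rewrite mulr_ge0 ?expR_ge0.
have H : \sum_(c < n) f c * expR (t * (if (K < c)%N then 0 else c%:R)) <=
    1 + t * (1 + b) * m.
  apply: (@le_trans _ _ (\sum_(c < n) (f c + t * (1 + b) * (c%:R * f c)))).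
    apply: ler_sum => c _.
    rewrite [leRHS](_ : _ = f c * (1 + t * (1 + b) * c%:R)); last by ring.
    rewrite ler_wpM2l//; case: ltnP => [_|cK].
      by rewrite mulr0 expR0 lerDl mulr_ge0// mulr_ge0 ?addr_ge0// ltW.
    have cKR : (c%:R : R) <= K%:R by rewrite ler_nat.
    have c0 : (0 : R) <= c%:R by [].
    have tc : t * c%:R <= t * K%:R by rewrite ler_wpM2l// ltW.
    have tc0 : 0 <= t * c%:R by rewrite mulr_ge0// ltW.
    apply: le_trans (expR_le_quadratic _ _) _ => //; first lra.
    have : 2 * (t * c%:R) ^+ 2 <= t * c%:R * b.
      rewrite -tK expr2 mulrCA ler_wpM2l//; lra.
    nra.
  by rewrite big_split /= -mulr_sumr lerD// ler_wpM2l// mulr_ge0 ?addr_ge0// ltW.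
apply: le_trans (ler_wpM2l (expR_ge0 _) H) _.
apply: le_trans (ler_wpM2l (expR_ge0 _) (expR_ge1Dx _)) _.
rewrite -expRD ler_expR.
have -> : b ^+ 2 / (2 * K%:R) = t * b by rewrite /t; ring.
have bm : b * m <= b by rewrite ler_piMr// ltW.
rewrite -subr_ge0 (_ : _ - _ = t * (1 - 2 * b - m - b * m)); last by ring.
have b1 : 3 * b = 1 - m by rewrite /b; lra.
by rewrite mulr_ge0 ?(ltW t0)//; clearbody b; lra.
Qed.

End Walk.

(** * The conditioning event is not exponentially unlikely *)

(** The arithmetic of [spine_weight_subexp]: of the [n] steps, [n'] typical ones
    have sum [s], then [k] steps have sum [x], then [j] steps equal [c], and the
    remaining [z] steps vanish. *)
Lemma block_sizes q c C n (n' := (n - n %/ q)%N) :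
  (2 <= q)%N -> (2 * q <= c)%N -> (q * (2 * C + 2) <= n)%N -> (c < n)%N ->
  [/\ (0 < n')%N, (n' <= n)%N,
    forall s x, (s <= n')%N -> (x <= C)%N -> (s + x <= n - 1)%N &
    forall s x j k (z := (n - n' - k - j)%N), (s <= n')%N -> (x <= C)%N -> (k <= C)%N ->
      (n - 1 - s - x = j * c)%N ->
      [/\ n = (n' + (k + (j + z)))%N, (n - 1 = s + (x + (c * j + 0 * z)))%N,
        (c * j <= n)%N & (q * z <= n)%N]].
Proof.
move=> q2 cq nC cn; have q0 : (0 < q)%N by lia.
have nq : (2 * C + 2 <= n %/ q)%N by rewrite leq_divRL// mulnC.
have nq2 : (n %/ q <= n %/ 2)%N by apply: leq_div2l.
have nqn : (n %/ q * q <= n)%N by exact: leq_trunc_div.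
have H s x : (s <= n')%N -> (x <= C)%N -> (s + x <= n - 1)%N by rewrite /n'; lia.
split; rewrite ?leq_subr//; first by rewrite /n'; lia.
move=> s x j k z sn xC kC jE; have sx := H s x sn xC.
have cj : (c * j <= n)%N by rewrite mulnC -jE; lia.
have jq : (2 * j <= n %/ q)%N.
  by rewrite leq_divRL//; apply: leq_trans cj; rewrite mulnAC leq_mul.
split => //; rewrite ?/z ?/n' ?mul0n; first by lia.
  by rewrite addn0 mulnC -jE; lia.
apply: leq_trans nqn; rewrite mulnC leq_mul//; lia.
Qed.

Lemma residue_eq n c s x : (0 < c)%N -> (s + x <= n - 1)%N ->
  x = (n - 1 + s * (c - 1))%N %[mod c] -> (c %| n - 1 - s - x)%N.
Proof.
move=> c0 sn xx; rewrite -subnDA -eqn_mod_dvd//; apply/eqP.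
rewrite -modnDmr xx modnDmr addnCA -mulnS (subn1 c) prednK//.
by rewrite addnC modnMDl.
Qed.

Lemma expR_absorb (R : realType) (e kap : R) n : 0 < e -> 0 < kap -> (0 < n)%N ->
  4 / (e ^+ 2 * kap) <= n%:R -> expR (- (e * n%:R)) <= kap / n.+1%:R.
Proof.
move=> e0 kap0 n0 en.
rewrite expRN -[leRHS]invrK lef_pV2 ?posrE ?expR_gt0 ?invr_gt0 ?divr_gt0// invf_div.
have := expR_ge1Dxn 1 (x := e * n%:R) ltac:(rewrite mulr_ge0// ltW//).
apply: le_trans; rewrite ler_pdivrMr// (_ : 2`! = 2%N)//.
rewrite ler_pdivrMr ?mulr_gt0 ?exprn_gt0// in en.
have nR : 1 <= n%:R :> R by rewrite ler1n.
have : 4 * n%:R <= n%:R * (e ^+ 2 * kap) * n%:R by rewrite ler_wpM2r.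
rewrite -(natr1 n) => H.
rewrite (_ : _ * kap = kap + n%:R * (e ^+ 2 * kap) * n%:R / 2); last by ring.
lra.
Qed.

Section LowerBound.
Variables (R : realType) (f : nat -> R).
Hypothesis f_ge0 : forall c, 0 <= f c.
Local Notation p := (step_poly f).

(* The coefficient of degree [s] of [p N ^+ k] is the probability that [k]
   independent steps, all less than [N], have sum [s]. *)
Lemma step_pow_ge0 N k s : 0 <= (p N ^+ k)`_s.
Proof.
elim: k s => [|k IH] s; first by rewrite expr0 coef1; case: eqP.
rewrite exprS coefM sumr_ge0// => i _; rewrite mulr_ge0// coef_poly.
by case: ifP.
Qed.

Lemma step_pow_mono B N k s : (B <= N)%N -> (p B ^+ k)`_s <= (p N ^+ k)`_s.
Proof.
move=> BN; elim: k s => [|k IH] s; first by rewrite !expr0.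
rewrite !exprS !coefM ler_sum// => i _; rewrite ler_pM ?step_pow_ge0//.
  by rewrite coef_poly; case: ifP.
rewrite !coef_poly; case: ltnP => [iB|_]; first by rewrite (leq_trans iB BN).
by case: ifP.
Qed.

Lemma step_pow_supermul N j k x y :
  (p N ^+ j)`_x * (p N ^+ k)`_y <= (p N ^+ (j + k))`_(x + y).
Proof.
rewrite exprD coefM.
have xy : (x < (x + y).+1)%N by rewrite ltnS leq_addr.
rewrite (bigD1 (Ordinal xy))//= addKn lerDl sumr_ge0// => i _.
by rewrite mulr_ge0 ?step_pow_ge0.
Qed.

Lemma step_pow_supermul4 N i j k l x y z w :
  (p N ^+ i)`_x * ((p N ^+ j)`_y * ((p N ^+ k)`_z * (p N ^+ l)`_w)) <=
  (p N ^+ (i + (j + (k + l))))`_(x + (y + (z + w))).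
Proof.
apply: le_trans (step_pow_supermul _ _ _ _ _); rewrite ler_wpM2l ?step_pow_ge0//.
apply: le_trans (step_pow_supermul _ _ _ _ _); rewrite ler_wpM2l ?step_pow_ge0//.
exact: step_pow_supermul.
Qed.

Lemma step_pow_iter N k s j : (p N ^+ k)`_s ^+ j <= (p N ^+ (k * j))`_(s * j).
Proof.
elim: j => [|j IH]; first by rewrite !muln0 !expr0 coef1.
rewrite exprS !mulnS; apply: le_trans (step_pow_supermul _ _ _ _ _).
by rewrite ler_wpM2l// step_pow_ge0.
Qed.

Lemma horner1_coef (q : {poly R}) : q.[1] = \sum_(i < size q) q`_i.
Proof. by rewrite horner_coef; apply: eq_bigr => i _; rewrite expr1n mulr1. Qed.

Lemma horner1_deriv (q : {poly R}) : q^`().[1] = \sum_(i < size q) i%:R * q`_i.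
Proof.
rewrite (@horner_coef_wide _ (size q)); last first.
  have [->|q0] := eqVneq q 0; first by rewrite deriv0.
  by rewrite ltnW// lt_size_deriv.
case E : (size q) => [|k]; first by rewrite !big_ord0.
rewrite [RHS]big_ord_recl mul0r add0r big_ord_recr /= coef_deriv.
rewrite [q`_k.+1]nth_default ?E// mul0rn mul0r addr0.
by apply: eq_bigr => i _; rewrite coef_deriv expr1n mulr1 mulr_natl.
Qed.

(** Markov's inequality: as the mean is below 1, it is likely that [k] steps have
    sum at most [k], hence one of the [k + 1] possible sums is likely. *)
Lemma exists_likely_sum (m : R) B k : (0 < k)%N ->
  \sum_(c < B) c%:R * f c <= m ->
  let F := \sum_(c < B) f c in
  exists2 s, (s <= k)%N & F ^+ k.-1 * (F - m) / k.+1%:R <= (p B ^+ k)`_s.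
Proof.
move=> k0 fm F; set v := _ / _.
have kR : 0 < k%:R :> R by rewrite ltr0n.
have [//|H] := pselect (exists2 s, (s <= k)%N & v <= (p B ^+ k)`_s).
have lt_v s : (s <= k)%N -> (p B ^+ k)`_s < v.
  by move=> sk; rewrite ltNge; apply/negP => ?; apply: H; exists s.
have F0 : 0 <= F by exact: sumr_ge0.
pose q := p B ^+ k.
have q1 : q.[1] = F ^+ k.
  by rewrite horner_exp horner_poly; congr (_ ^+ _); apply: eq_bigr => i _; rewrite expr1n mulr1.
have q'1 : q^`().[1] <= k%:R * F ^+ k.-1 * m.
  rewrite deriv_exp hornerMn hornerM -mulr_natl -[leRHS]mulrA.
  have -> : (p B)^`().[1] = \sum_(c < B) c%:R * f c.
    have := congr1 (horner^~ 1) (mulX_deriv_step f B).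
    rewrite /= hornerM hornerX mul1r horner_poly => ->.
    by apply: eq_bigr => i _; rewrite expr1n mulr1.
  rewrite ler_wpM2l//.
  rewrite (_ : (p B ^+ k.-1).[1] = F ^+ k.-1).
    by rewrite mulrC ler_wpM2l ?exprn_ge0.
  by rewrite horner_exp horner_poly; congr (_ ^+ _); apply: eq_bigr => i _; rewrite expr1n mulr1.
(* The weight [1 - i / k] is at most 1, and nonpositive when [i >= k]. *)
have lo : F ^+ k.-1 * (F - m) <= \sum_(i < size q) (1 - i%:R / k%:R) * q`_i.
  rewrite (_ : \sum_(i < _) _ = q.[1] - k%:R^-1 * q^`().[1]); last first.
    rewrite horner1_coef horner1_deriv mulr_sumr -sumrB.
    by apply: eq_bigr => i _; ring.
  rewrite q1 mulrBr -exprSr prednK// lerD2l lerN2 mulrC ler_pdivrMr//.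
  by rewrite [leRHS]mulrC mulrA.
have : F ^+ k.-1 * (F - m) < v * k.+1%:R.
  apply: le_lt_trans lo _.
  apply: (@le_lt_trans _ _ (\sum_(0 <= i < k.+1) q`_i)).
    rewrite -(big_mkord xpredT (fun i => (1 - i%:R / k%:R) * q`_i)).
    apply: (@le_trans _ _ (\sum_(0 <= i < maxn (size q) k.+1) (if (i < k.+1)%N then q`_i else 0))).
      rewrite [leRHS](big_cat_nat (n := size q))//= ?leq_maxl// -[leLHS]addr0 lerD//.
        apply: ler_sum => i _; case: ltnP => ik.
          by rewrite ler_piMl ?step_pow_ge0// lerBlDr lerDl divr_ge0.
        rewrite mulr_le0_ge0 ?step_pow_ge0// subr_le0 ler_pdivlMr// mul1r ler_nat; lia.
      by apply: sumr_ge0 => i _; case: ifP => // _; exact: step_pow_ge0.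
    rewrite (big_cat_nat (n := k.+1))//= ?leq_maxr// [X in _ + X]big_nat_cond [X in _ + X]big1 ?addr0.
      by apply: ler_sum_nat => i /andP[_ ->].
    by move=> i /andP[/andP[ki _] _]; rewrite ltnNge ki.
  apply: (@lt_le_trans _ _ (\sum_(0 <= i < k.+1) v)).
    by apply: ltr_sum_nat => // i /andP[_ ik]; exact: lt_v.
  by rewrite sumr_const_nat subn0 [leRHS]mulr_natr.
by rewrite /v divfK ?ltxx// pnatr_eq0.
Qed.

(** There are finitely many residues modulo [c], so those that are attained by
    some sum of steps are attained with probability bounded below, by sums of
    bounded size with a bounded number of steps. *)
Lemma residue_realizers c : exists C eta, 0 < eta :> R /\
  forall N k x, 0 < (p N ^+ k)`_x -> (0 < c)%N ->
  exists k' x', [/\ (k' <= C)%N, (x' <= C)%N, x' = x %[mod c] & eta <= (p C ^+ k')`_x'].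
Proof.
suff H r : exists C eta, 0 < eta :> R /\
  forall N k x, 0 < (p N ^+ k)`_x -> (x %% c < r)%N ->
  exists k' x', [/\ (k' <= C)%N, (x' <= C)%N, x' = x %[mod c] & eta <= (p C ^+ k')`_x'].
  have [C [eta [e0 H']]] := H c; exists C, eta; split=> // N k x px c0.
  by apply: (H' N k x) => //; rewrite ltn_mod.
elim: r => [|r [C [eta [e0 IH]]]]; first by exists 0%N, 1.
have [[N [k [x [px xr]]]]|no] := pselect (exists N k x, 0 < (p N ^+ k)`_x /\ (x %% c)%N = r).
  exists (maxn (maxn C N) (maxn k x)), (Num.min eta (p N ^+ k)`_x).
  split=> [|N' k' x' px']; first by rewrite lt_min e0.
  rewrite ltnS leq_eqVlt => /orP[/eqP xr'|xr'].
    exists k, x; split; rewrite ?xr ?xr'//; try lia.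
    by rewrite ge_min; apply/orP; right; apply: step_pow_mono; lia.
  have [k1 [x1 [kC xC xx e1]]] := IH N' k' x' px' xr'.
  exists k1, x1; split=> //; try lia.
  rewrite ge_min; apply/orP; left; apply: le_trans e1 _; apply: step_pow_mono; lia.
exists C, eta; split=> // N k x px; rewrite ltnS leq_eqVlt => /orP[/eqP xr|]; last exact: (IH N k x px).
by case: no; exists N, k, x.
Qed.

Variable m : R.
Hypothesis m_lt1 : m < 1.
Hypothesis mean_le : forall N, \sum_(c < N) c%:R * f c <= m.
Hypothesis mass1 : forall e, 0 < e -> exists B, 1 - e <= \sum_(c < B) f c.
Hypothesis heavy_tail : forall e N, 0 < e -> exists2 c, (N <= c)%N & expR (- (e * c%:R)) <= f c.

(** The mean is at least the probability of a positive value. *)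
Lemma leaf_prob_gt0 : 0 < f 0.
Proof.
have [B FB] := mass1 (e := (1 - m) / 2) ltac:(rewrite divr_gt0// subr_gt0//).
have := mean_le B; case: B FB => [|B]; first by rewrite !big_ord0; have := m_lt1; lra.
rewrite !big_ord_recl mul0r add0r => FB mB.
have : \sum_(i < B) f (lift ord0 i) <= \sum_(i < B) (lift ord0 i)%:R * f (lift ord0 i).
  by apply: ler_sum => i _; rewrite ler_peMl// ler1n.
have := m_lt1; move: FB mB; rewrite /=; lra.
Qed.

(** Let most of the steps have a likely sum [s], at most their number.  The missing
    amount [n - 1 - s] is produced by few steps equal to some large [c] with
    [f c >= exp(- e c)], at a total cost of at most [exp(- e n)], and the steps
    left over vanish.  It remains to adjust [n - 1 - s] modulo [c].  The residues
    of attainable sums are closed under addition, and [n - 1 - s] is congruent to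
    [n - 1 + (c - 1) s], where [n - 1] is attainable by assumption; hence boundedly
    many steps suffice. *)
Lemma spine_weight_subexp (eps : R) : 0 < eps -> exists n0, forall n, (n0 <= n)%N ->
  0 < spine_weight f n 0 n 1 -> expR (- (eps * n%:R)) <= spine_weight f n 0 n 1.
Proof.
move=> eps0; pose e := eps / 4.
have e0 : 0 < e by rewrite divr_gt0.
pose L := - ln (f 0).
have f0E : f 0 = expR (- L) by rewrite opprK lnK// posrE leaf_prob_gt0.
have [q q2 qL] : exists2 q : nat, (2 <= q)%N & L <= e * q%:R.
  exists (Num.truncn `|L / e|).+2 => //.
  rewrite mulrC -ler_pdivrMr//; apply: le_trans (ler_norm _) _.
  apply: ltW; apply: lt_trans (truncnS_gt _) _; by rewrite ltr_nat.
have q0 : (0 < q)%N by lia.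
have [c cq fc] := heavy_tail (2 * q) e0.
have c0 : (0 < c)%N by lia.
have [C [eta [eta0 HC]]] := residue_realizers c.
(* Truncating the law at [B] loses so little mass that even [n] steps stay below
   [B] with probability [exp(- e n)], and the mean stays below the mass. *)
pose de := Num.min ((1 - m) / 2) (1 - expR (- e)).
have de0 : 0 < de.
  by rewrite lt_min divr_gt0 ?subr_gt0//= expR_lt1 oppr_lt0.
have [B FB] := mass1 de0; set F := \sum_(c < B) f c in FB.
have Fe : expR (- e) <= F.
  by apply: le_trans FB; rewrite lerBrDl -lerBrDr ge_min lexx orbT.
have Fm : (1 - m) / 2 <= F - m.
  have : de <= (1 - m) / 2 by rewrite ge_min lexx.
  move: FB; lra.
pose kap := eta * ((1 - m) / 2).
have kap0 : 0 < kap by rewrite mulr_gt0// divr_gt0// subr_gt0.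
pose n1 := (Num.truncn (4 / (e ^+ 2 * kap))).+1.
pose n0 := (n1 + q * (2 * C + 2) + B + C + c + 1)%N.
have n0P n : (n0 <= n)%N -> [/\ (n1 <= n)%N, (q * (2 * C + 2) <= n)%N, (B <= n)%N,
    (C <= n)%N & (c < n)%N].
  by clear; rewrite /n0; split; lia.
exists n0 => n /n0P[nn1 nC Bn Cn cn].
have n_gt0 : (0 < n)%N by exact: leq_ltn_trans cn.
rewrite /spine_weight n_gt0 expr0 mul1r subn0 => wn.
pose n' := (n - n %/ q)%N.
have [n'0 n'n fits blocks] := block_sizes q2 cq nC cn; rewrite -/n' in n'0 n'n fits blocks.
have [s sn' ps] := exists_likely_sum n'0 (mean_le B).
rewrite -/F in ps.
have ps_pos : 0 < (p B ^+ n')`_s.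
  apply: lt_le_trans ps; rewrite divr_gt0// mulr_gt0 ?exprn_gt0//.
    exact: lt_le_trans (expR_gt0 _) Fe.
  by apply: lt_le_trans Fm; rewrite divr_gt0// subr_gt0.
have px : 0 < (p n ^+ (n + n' * (c - 1)))`_(n - 1 + s * (c - 1)).
  apply: lt_le_trans (step_pow_supermul _ _ _ _ _); rewrite mulr_gt0//.
  apply: lt_le_trans (step_pow_iter _ _ _ _); rewrite exprn_gt0//.
  by apply: lt_le_trans ps_pos _; exact: step_pow_mono.
have [k' [x' [kC xC xx pk]]] := HC _ _ _ px c0.
have [j jE] : exists j, (n - 1 - s - x' = j * c)%N.
  by apply/dvdnP; apply: residue_eq => //; exact: fits.
pose z := (n - n' - k' - j)%N.
have [nE n1E cjn qz] := blocks s x' j k' sn' xC kC jE; rewrite -/z in nE n1E qz.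
have := step_pow_supermul4 n n' k' j z s x' (c * j) (0 * z).
rewrite -nE -n1E => chain; apply: le_trans chain.

have single d i : (d < n)%N -> f d ^+ i <= (p n ^+ i)`_(d * i).
  move=> dn; have := step_pow_iter n 1 d i; rewrite mul1n; apply: le_trans.
  by rewrite expr1 coef_poly dn.
have b1 : expR (- (e * n%:R)) * ((1 - m) / 2) / n.+1%:R <= (p n ^+ n')`_s.
  apply: le_trans (step_pow_mono (N := n) _ _ Bn).
  apply: le_trans ps.
  have p1 : expR (- (e * n%:R)) <= F ^+ n'.-1.
    apply: (@le_trans _ _ (expR (- e) ^+ n'.-1)); last first.
      by rewrite lerXn2r// nnegrE ?expR_ge0// (le_trans (expR_ge0 _) Fe).
    rewrite -expRM_natl ler_expR mulrN lerN2 mulrC ler_wpM2l ?(ltW e0)// ler_nat.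
    by rewrite (leq_trans (leq_pred _)).
  apply: ler_pM => //; first by rewrite mulr_ge0 ?expR_ge0// divr_ge0// subr_ge0 ltW.
    by rewrite ler_pM ?expR_ge0// divr_ge0// subr_ge0 ltW.
  by rewrite lef_pV2 ?posrE// ler_nat ltnS leq_subr.
have b2 : eta <= (p n ^+ k')`_x'.
  by apply: le_trans pk _; exact: step_pow_mono.
have b3 : expR (- (e * n%:R)) <= (p n ^+ j)`_(c * j).
  apply: le_trans (single c j _) => //.
  apply: (@le_trans _ _ (expR (- (e * c%:R)) ^+ j)); last first.
    by rewrite lerXn2r// nnegrE ?expR_ge0.
  rewrite -expRM_natl ler_expR mulrN lerN2 mulrCA ler_wpM2l ?(ltW e0)// -natrM ler_nat.
  by rewrite mulnC.
have b4 : expR (- (e * n%:R)) <= (p n ^+ z)`_(0 * z).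
  apply: le_trans (single 0%N z _) => //.
  rewrite f0E -expRM_natl ler_expR mulrN lerN2.
  apply: (@le_trans _ _ (z%:R * (e * q%:R))); first by rewrite ler_wpM2l.
  rewrite mulrCA ler_wpM2l ?(ltW e0)// -natrM ler_nat.
  by rewrite mulnC.
have bn : expR (- (e * n%:R)) <= kap / n.+1%:R.
  apply: expR_absorb => //.
  by apply: ltW; apply: lt_le_trans (truncnS_gt _) _; rewrite ler_nat.
apply: (@le_trans _ _ ((expR (- (e * n%:R)) * ((1 - m) / 2) / n.+1%:R) *
  (eta * (expR (- (e * n%:R)) * expR (- (e * n%:R)))))).
  rewrite (_ : _ * (eta * _) = expR (- (e * n%:R)) * expR (- (e * n%:R)) *
    expR (- (e * n%:R)) * (kap / n.+1%:R)); last by rewrite /kap; ring.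
  apply: le_trans (ler_wpM2l _ bn); last by rewrite !mulr_ge0 ?expR_ge0.
  by rewrite -!expRD ler_expR /e; lra.
have m0 : 0 <= (1 - m) / 2 by rewrite divr_ge0// subr_ge0 ltW.
apply: ler_pM => //; first by rewrite divr_ge0// mulr_ge0 ?expR_ge0.
  by rewrite !mulr_ge0 ?expR_ge0// ltW.
apply: ler_pM => //; do ?[exact: ltW | by rewrite mulr_ge0 ?expR_ge0].
by apply: ler_pM; rewrite ?expR_ge0.
Qed.

End LowerBound.

(** * Recursions for the spine weight *)

(** One more step of the walk corresponds to revealing the number [c] of children
    of one pending node, which turns [j + 1] pending nodes into [j + c]. *)
Section Recursion.
Variables (R : realType) (f : nat -> R) (N : nat).
Local Notation sw := (spine_weight f N).

Lemma coef_poly_mulE (a : nat -> R) (Q : {poly R}) n j : (j <= n)%N -> (n < N)%N ->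
  (\poly_(c < N) a c * Q)`_(n - j) =
  \sum_(c < N) a c * (if (j + c <= n)%N then Q`_(n - (j + c)) else 0).
Proof.
move=> jn nN; have le : ((n - j).+1 <= N)%N by lia.
rewrite coefM (big_ord_widen _ (fun i => (\poly_(c < N) a c)`_i * Q`_(n - j - i)) le).
rewrite big_mkcond; apply: eq_bigr => i _; rewrite coef_poly ltn_ord.
rewrite ltnS leq_subRL// subnDA; case: ifP => // _; by rewrite mulr0.
Qed.

Lemma spine_weight_eq0 h n j : (n - j < h)%N -> sw h n j = 0.
Proof.
by move=> lt; rewrite /spine_weight; case: ifP => // jn; rewrite exprMn -mulrA coefXnM lt.
Qed.

Lemma spine_weight_gt h n j : (n < j)%N -> sw h n j = 0.
Proof. by rewrite /spine_weight ltnNge; case: (j <= n)%N. Qed.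

Lemma spine_weight_rest h n j : (n < N)%N ->
  \sum_(c < N) f c * sw h n (j + c) = sw h n.+1 j.+1.
Proof.
move=> nN; have [jn|nj] := leqP j n; last first.
  rewrite spine_weight_gt// big1// => c _.
  by rewrite spine_weight_gt ?mulr0// (leq_trans nj) ?leq_addr.
have [hn|nh] := leqP h n; last first.
  rewrite [RHS]spine_weight_eq0 ?big1//; last by lia.
  by move=> c _; rewrite spine_weight_eq0 ?mulr0//; lia.
rewrite [RHS]/spine_weight ltnS jn subSS subSn// exprS mulrCA {2}/step_poly.
by rewrite coef_poly_mulE.
Qed.

Lemma spine_weight_child h n j : (n < N)%N ->
  \sum_(c < N) f c * (c%:R * sw h n (j + c)) = sw h.+1 n.+1 j.+1.
Proof.
move=> nN; have [jn|nj] := leqP j n; last first.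
  rewrite [RHS]spine_weight_gt// big1// => c _.
  by rewrite spine_weight_gt ?mulr0// (leq_trans nj) ?leq_addr.
rewrite [RHS]/spine_weight ltnS jn !subSS exprS -mulrA {1}mulX_deriv_step.
rewrite coef_poly_mulE//; apply: eq_bigr => c _.
by rewrite /spine_weight mulrA (mulrC (f c)).
Qed.

(** Exchangeability: given [S_(n+1) = n - j], each step has mean
    [(n - j) / (n + 1)].  In terms of generating functions, this is the derivative
    of the power [n + 1] of the polynomial of the steps. *)
Lemma spine_weight_exchange n j :
  n.+1%:R * sw 1 n.+1 j.+1 = (n - j)%:R * sw 0 n.+1 j.+1.
Proof.
rewrite /spine_weight ltnS; case: leqP => _; last by rewrite !mulr0.
rewrite !subSS !subn0 expr1 expr0 mul1r mulr_natl -coefMn -mulrA -mulrnAr.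
rewrite -(deriv_exp (step_poly f N) n.+1) coefXM coef_deriv.
by case: (n - j)%N => [|k] /=; rewrite ?mul0r// mulr_natl.
Qed.

End Recursion.

(** * Plane trees of a given size *)

(** The range of the search exceeds every letter that occurs in [t], so the search
    always succeeds. *)
Definition outdegree (t : {fset node}) (u : node) : nat :=
  find (fun i => rcons u i \notin t) (iota 0 (\max_(v <- t) last 0%N v).+1).

Lemma mem_outdegree (t : {fset node}) u i : ulam_harris t ->
  (rcons u i \in t) = (i < outdegree t u)%N.
Proof.
case=> _ _ sib; rewrite /outdegree; set m := \max_(v <- t) _; set p := fun _ => _.
have le : (find p (iota 0 m.+1) <= m.+1)%N by have := find_size p (iota 0 m.+1); rewrite size_iota.
apply/idP/idP => [it|lt]; last first.
  have := @before_find _ 0%N p (iota 0 m.+1) i lt.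
  by rewrite nth_iota ?add0n; [rewrite /p => /negbFE | exact: leq_trans le].
rewrite ltnNge; apply/negP => ki.
have im : (i <= m)%N.
  by have := @leq_bigmax_seq _ (enum_fset t) xpredT (last 0%N) _ it isT; rewrite last_rcons.
have hp : has p (iota 0 m.+1) by rewrite has_find size_iota; exact: leq_ltn_trans ki _.
have := nth_find 0%N hp; rewrite nth_iota; last exact: leq_ltn_trans ki _.
rewrite add0n {1}/p; move: ki; rewrite leq_eqVlt => /orP[/eqP ->|lt]; first by rewrite it.
by rewrite (sib _ _ _ lt it).
Qed.

Definition kids (u : node) c : seq node := [seq rcons u i | i <- iota 0 c].

Lemma mem_kids u c v i : (rcons v i \in kids u c) = (v == u) && (i < c)%N.
Proof.
apply/mapP/idP => [[k]|/andP[/eqP -> ic]].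
  by rewrite mem_iota => /andP[_ kc] /rcons_inj[-> ->]; rewrite eqxx.
by exists i => //; rewrite mem_iota.
Qed.

Lemma kids_uniq u c : uniq (kids u c).
Proof. by rewrite map_inj_uniq ?iota_uniq// => i j /rcons_inj[]. Qed.

Lemma notin_kids u c : u \notin kids u c.
Proof.
by apply/mapP => -[i _ E]; have := congr1 size E; rewrite size_rcons; lia.
Qed.

Lemma plane_treeP (t : plane_tree) : ulam_harris (nodes t).
Proof. by case: t => t h; apply/asboolP. Qed.

Lemma outdegree_lt (t : plane_tree) u : u \in nodes t ->
  (outdegree (nodes t) u < #|` nodes t|)%N.
Proof.
move=> ut; have := @uniq_leq_size _ (u :: kids u (outdegree (nodes t) u)) (nodes t).
rewrite /= notin_kids kids_uniq size_map size_iota => /(_ isT); apply.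
move=> v; rewrite inE => /orP[/eqP -> //|/mapP[i]]; rewrite mem_iota => /andP[_ ic] ->.
by rewrite mem_outdegree//; exact: plane_treeP.
Qed.

Lemma prefix_rconsE (T : eqType) (v u : seq T) x :
  prefix v (rcons u x) = (v == rcons u x) || prefix v u.
Proof.
rewrite !prefixE; have [le|lt] := leqP (size v) (size u).
  rewrite -cats1 takel_cat// orb_idl// => /eqP E.
  by move: le; rewrite E size_cat /=; lia.
rewrite take_oversize ?size_rcons// eq_sym; case: eqP => //= _.
by rewrite take_oversize 1?ltnW//; apply/esym/eqP => E; move: lt; rewrite E ltnn.
Qed.

Lemma prefix_in_tree (t : {fset node}) u v : ulam_harris t ->
  prefix v u -> u \in t -> v \in t.
Proof.
case=> _ par _; elim/last_ind: u => [|u i IH]; first by rewrite prefixs0 => /eqP ->.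
rewrite prefix_rconsE => /orP[/eqP ->//|vu ui]; exact: IH vu (par _ _ ui).
Qed.

Fixpoint words n k : seq node :=
  if k is k'.+1 then
    [::] :: [seq i :: u | i <- iota 0 n, u <- words n k'] else [:: [::]].

Lemma mem_words n k (u : node) : (size u <= k)%N -> all (fun i => (i < n)%N) u ->
  u \in words n k.
Proof.
elim: k u => [|k IH] [|i u]//= su /andP[ilt au]; rewrite inE; apply/orP; right.
by apply: allpairs_f; [rewrite mem_iota | exact: IH].
Qed.

Lemma node_size_lt (t : plane_tree) u : u \in nodes t -> (size u < #|` nodes t|)%N.
Proof.
move=> ut; have := @uniq_leq_size _ [seq take k u | k <- iota 0 (size u).+1] (nodes t).
rewrite size_map size_iota; apply.
  rewrite map_inj_in_uniq ?iota_uniq// => i j; rewrite !mem_iota !add0n !ltnS /= => iu ju.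
  by move=> /(congr1 size); rewrite !size_takel.
move=> v /mapP[k _ ->]; apply: prefix_in_tree ut; first exact: plane_treeP.
exact: prefix_take.
Qed.

Lemma node_letter_lt (t : plane_tree) u : u \in nodes t ->
  all (fun i => (i < #|` nodes t|)%N) u.
Proof.
have [_ par _] := plane_treeP t.
elim/last_ind: u => //= u i IH ut; rewrite all_rcons IH ?(par _ _ ut)// andbT.
apply: ltn_trans (outdegree_lt (par _ _ ut)).
by rewrite -mem_outdegree//; exact: plane_treeP.
Qed.

(** Prefixes and left siblings of nodes are nodes, so in a tree of size [n] both
    the length and the letters of a node are less than [n]. *)
Lemma finite_trees n : finite_set [set t : plane_tree | #|` nodes t| = n].
Proof.
pose W := [fset u in words n n]%fset.
apply: (@sub_finite_set _ _ (nodes @^-1` [set` fpowerset W])).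
  move=> t /= tn; rewrite fpowersetE; apply/fsubsetP => u ut.
  rewrite inE mem_words// -tn; first exact/ltnW/node_size_lt.
  exact: node_letter_lt.
apply: finite_preimage => [s t _ _|]; first exact: val_inj.
exact: finite_fset.
Qed.

Definition trees n : seq plane_tree := fset_set [set t : plane_tree | #|` nodes t| = n].

Lemma mem_trees n (t : plane_tree) : (t \in trees n) = (#|` nodes t| == n).
Proof.
rewrite in_fset_set; last exact: finite_trees.
by apply/idP/idP; rewrite ?inE => /eqP.
Qed.

Lemma trees_uniq n : uniq (trees n). Proof. exact: fset_uniq. Qed.

(** * Summing over trees by exploration *)

(** A state of the exploration: [A] lists the nodes whose children are known, and
    [L] the pending nodes, known to belong to the tree but with unknown children.
    The third clause makes the pending nodes leaves of the known part. *)
Definition frontier (A L : seq node) : Prop :=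
  [/\ uniq (A ++ L), [::] \in A ++ L,
      forall u i, rcons u i \in A ++ L -> u \in A &
      forall u i j, (i < j)%N -> rcons u j \in A ++ L -> rcons u i \in A ++ L].

Definition extends (A L : seq node) (t : {fset node}) : Prop :=
  {subset A ++ L <= t} /\
  (forall u i, u \in A -> rcons u i \in t -> rcons u i \in A ++ L).

Lemma frontier_step A u L c : frontier A (u :: L) -> frontier (u :: A) (kids u c ++ L).
Proof.
case=> un r par sib.
have memE v : (v \in (u :: A) ++ (kids u c ++ L)) = (v \in kids u c) || (v \in A ++ u :: L).
  by rewrite !(inE, mem_cat); do ![case: (_ \in _) | case: (_ == _)].
have uA : u \notin A.
  by move: un; rewrite cat_uniq /= => /and3P[_ /norP[]].
have kidsN i : rcons u i \notin A ++ u :: L by apply: contra uA => /par.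
split.
- have un' : uniq (u :: A ++ L).
    by rewrite -(perm_uniq (s1 := A ++ u :: L))// -cat1s perm_catCA.
  rewrite (perm_uniq (s2 := kids u c ++ (u :: A ++ L))); last first.
    by rewrite -cat_cons perm_catCA.
  rewrite cat_uniq kids_uniq un' andbT; apply/negP => /hasP[v vA /mapP[i _ vE]].
  move: (kidsN i); rewrite -vE => /negP; apply.
  by move: vA; rewrite !(inE, mem_cat); do ![case: (_ \in _) | case: (_ == _)].
- by rewrite memE r orbT.
- move=> v i; rewrite memE mem_kids inE => /orP[/andP[-> //]|/par ->].
  by rewrite orbT.
- move=> v i j ij; rewrite !memE !mem_kids => /orP[/andP[-> jc]|/(sib _ _ _ ij) ->].
    by rewrite (ltn_trans ij jc).
  by rewrite orbT.
Qed.

(** The trees compatible with a state are classified by the number [c] of children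
    of the first pending node; each class is described by another state. *)
Lemma extends_step A u L c t : frontier A (u :: L) -> ulam_harris t ->
  extends (u :: A) (kids u c ++ L) t <->
  extends A (u :: L) t /\ outdegree t u = c.
Proof.
case=> un r par sib tU.
have memE v : (v \in (u :: A) ++ (kids u c ++ L)) = (v \in kids u c) || (v \in A ++ u :: L).
  by rewrite !(inE, mem_cat); do ![case: (_ \in _) | case: (_ == _)].
have uA : u \notin A.
  by move: un; rewrite cat_uniq /= => /and3P[_ /norP[]].
have kidsN i : rcons u i \notin A ++ u :: L by apply: contra uA => /par.
split=> [[sub cl]|[[sub cl] dc]].
  have d i : (i < outdegree t u)%N = (i < c)%N.
    rewrite -mem_outdegree//; apply/idP/idP => [ui|ic].
      have := cl u i; rewrite inE eqxx => /(_ isT ui).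
      by rewrite memE mem_kids eqxx (negbTE (kidsN i)) orbF.
    by apply: sub; rewrite memE mem_kids eqxx ic.
  split; last first.
    apply/eqP; rewrite eqn_leq; apply/andP; split; first by rewrite leqNgt (d c) ltnn.
    by rewrite leqNgt -(d (outdegree t u)) ltnn.
  split=> [v vA|v i vA vt]; first by apply: sub; rewrite memE vA orbT.
  have := cl v i; rewrite inE vA orbT => /(_ isT vt).
  rewrite memE mem_kids; case: eqP => // vu.
  by move: vA uA; rewrite vu => ->.
subst c; split=> [v|v i].
  rewrite memE => /orP[/mapP[i]|/sub//].
  by rewrite mem_iota /= => id ->; rewrite mem_outdegree.
rewrite inE => /orP[/eqP ->|vA] vt; rewrite memE mem_kids.
  by rewrite eqxx -mem_outdegree// vt.
by rewrite (cl _ _ vA vt) orbT.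
Qed.

Lemma extends_size A L (t : {fset node}) : frontier A L -> extends A L t ->
  (size A + size L <= #|` t|)%N.
Proof.
by move=> [un _ _ _] [sub _]; rewrite -size_cat; exact: uniq_leq_size.
Qed.

Lemma extends_nil A (t : {fset node}) : frontier A [::] -> ulam_harris t ->
  extends A [::] t -> t =i A.
Proof.
move=> [un r par sib] [_ part _] [sub cl] v; apply/idP/idP; last first.
  by move=> vA; apply: sub; rewrite cats0.
elim/last_ind: v => [|v i IH vt]; first by rewrite -[A]cats0.
by have := cl v i (IH (part _ _ vt)) vt; rewrite cats0.
Qed.

Section ExploreSum.
Variables (R : realType) (f : nat -> R).

Definition offspring_weight (A : seq node) (t : {fset node}) : R :=
  \prod_(v <- t | v \notin A) f (outdegree t v).

Definition deep_count (h : nat) (A : seq node) (t : {fset node}) : R :=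
  \sum_(v <- t | v \notin A) (h <= size v)%N%:R.

Lemma offspring_weight_cons A u (t : {fset node}) : u \in t -> u \notin A ->
  offspring_weight A t = f (outdegree t u) * offspring_weight (u :: A) t.
Proof.
move=> ut uA; rewrite /offspring_weight big_mkcond /= (bigD1_seq u) ?fset_uniq//= uA.
congr (_ * _); rewrite -big_mkcondr; apply: eq_bigl => v.
by rewrite inE negb_or.
Qed.

Lemma deep_count_cons h A u (t : {fset node}) : u \in t -> u \notin A ->
  deep_count h A t = (h <= size u)%N%:R + deep_count h (u :: A) t.
Proof.
move=> ut uA; rewrite /deep_count big_mkcond /= (bigD1_seq u) ?fset_uniq//= uA.
congr (_ + _); rewrite -big_mkcondr; apply: eq_bigl => v.
by rewrite inE negb_or.
Qed.

(** The probability that the unexplored part of the tree completes the state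
    [(A, L)] to a tree with [size A + n] nodes, with [F] integrated over it. *)
Definition explore_sum (F : {fset node} -> R) A L n : R :=
  \sum_(t <- trees (size A + n) | `[< extends A L t >]) offspring_weight A t * F t.

(** Summation over the number of children of the first pending node.  A node has
    fewer children than the tree has nodes, so it suffices to let [c < N]. *)
Lemma explore_sum_step F A u L n N : frontier A (u :: L) -> (size A + n < N)%N ->
  explore_sum F A (u :: L) n.+1 =
  \sum_(c < N) f c * explore_sum F (u :: A) (kids u c ++ L) n.
Proof.
case: N => // M fr; rewrite ltnS => nM; rewrite /explore_sum addnS /=.
rewrite big_seq_cond.
rewrite (partition_big (fun t : plane_tree => inord (outdegree t u) : 'I_M.+1) predT)//=.
apply: eq_bigr => c _; rewrite mulr_sumr [RHS]big_seq_cond.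
have uA : u \notin A.
  by case: fr => un _ _ _; move: un; rewrite cat_uniq /= => /and3P[_ /norP[]].
have E t : ((t \in trees (size A + n).+1) && `[< extends A (u :: L) t >])
      && (inord (outdegree t u) == c) =
    (t \in trees (size A + n).+1) && `[< extends (u :: A) (kids u c ++ L) t >].
  have [tt|//] := boolP (t \in trees _); rewrite /=.
  have tU := plane_treeP t.
  have key : extends A (u :: L) t -> (inord (outdegree t u) == c) = (outdegree t u == c).
    case=> sub _; have ut : u \in nodes t by apply: sub; rewrite mem_cat inE eqxx orbT.
    have := outdegree_lt ut; move: tt; rewrite mem_trees => /eqP -> lt.
    by rewrite -val_eqE /= inordK// ltnS (leq_trans _ nM).
  apply/andP/asboolP => [[/asboolP e]|].
    by rewrite key// => /eqP d; apply/(extends_step _ fr tU).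
  move=> /(extends_step _ fr tU)[e d]; split; first exact/asboolP.
  by rewrite key//; apply/eqP.
rewrite (eq_bigl _ _ E).
apply: eq_bigr => t /andP[_ /asboolP e].
have [[sub _] d] := (extends_step c fr (plane_treeP t)).1 e.
have ut : u \in nodes t by apply: sub; rewrite mem_cat inE eqxx orbT.
by rewrite (offspring_weight_cons ut uA) d mulrA.
Qed.

Lemma explore_sum0 F A L : frontier A L -> L != [::] -> explore_sum F A L 0 = 0.
Proof.
move=> fr L0; rewrite /explore_sum big_seq_cond big1// => t /andP[].
rewrite mem_trees addn0 => /eqP tA /asboolP /(extends_size fr).
by rewrite tA -[leqRHS]addn0 leq_add2l leqn0 size_eq0 (negbTE L0).
Qed.

Lemma explore_sum_nil F A n : frontier A [::] -> explore_sum F A [::] n.+1 = 0.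
Proof.
move=> fr; rewrite /explore_sum big_seq_cond big1// => t /andP[].
rewrite mem_trees => /eqP tA /asboolP /(extends_nil fr (plane_treeP t)) e.
have [un _ _ _] := fr; rewrite cats0 in un.
have := uniq_size_uniq un (fun v => esym (e v)); rewrite fset_uniq => /esym/eqP.
move=> E; have : (size A + n.+1)%N = size A by rewrite -tA -[RHS]E.
by rewrite -[RHS]addn0 => /addnI.
Qed.

Lemma explored_weight A (t : {fset node}) : t =i A -> offspring_weight A t = 1.
Proof.
by move=> e; rewrite /offspring_weight big_seq_cond big1// => v /andP[]; rewrite e => ->.
Qed.

Lemma explored_count h A (t : {fset node}) : t =i A -> deep_count h A t = 0.
Proof.
by move=> e; rewrite /deep_count big_seq_cond big1// => v /andP[]; rewrite e => ->.
Qed.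

Lemma explore_sum_nil0 F A : frontier A [::] ->
  explore_sum F A [::] 0 = F [fset v in A]%fset.
Proof.
move=> fr; have [un r par sib] := fr; rewrite !cats0 in un r par sib.
pose tA := [fset v in A]%fset.
have tAE v : (v \in tA) = (v \in A) by rewrite inE.
have tU : `[< ulam_harris tA >].
  by apply/asboolP; split=> [|u i|u i j ij]; rewrite !tAE; [|exact: par|exact: sib].
pose t0 := PlaneTree tU.
have t0t : t0 \in trees (size A + 0).
  by rewrite mem_trees addn0 card_fseq undup_id.
rewrite /explore_sum big_mkcond (bigD1_seq t0) ?trees_uniq//= big1 ?addr0; last first.
  move=> t tt0; case: asboolP => // /(extends_nil fr (plane_treeP t)) e.
  case/eqP: tt0; apply: val_inj; apply/fsetP => v; by rewrite e tAE.
rewrite asboolT; first by rewrite explored_weight ?mul1r.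
by split=> [v|v i]; rewrite cats0 tAE.
Qed.

Lemma frontier_notin A u L : frontier A (u :: L) -> u \notin A.
Proof. by case=> un _ _ _; move: un; rewrite cat_uniq /= => /and3P[_ /norP[]]. Qed.

Lemma size_kids u c : size (kids u c) = c.
Proof. by rewrite size_map size_iota. Qed.

(** The hitting time theorem: a forest of [j] trees has size [n] with probability
    [(j / n) P(S_n = n - j)].  Both sides satisfy the same recursion, by
    [spine_weight_rest], [spine_weight_child] and [spine_weight_exchange]. *)
Lemma explore_total N n A L : frontier A L -> (size A + n <= N)%N ->
  n%:R * explore_sum (fun=> 1) A L n = (size L)%:R * spine_weight f N 0 n (size L).
Proof.
elim: n A L => [|n IH] A [|u L] fr; rewrite ?addnS ?addn0 => AN.
- by rewrite !mul0r.
- by rewrite mul0r spine_weight_gt ?mulr0.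
- by rewrite explore_sum_nil// mulr0 mul0r.
rewrite (explore_sum_step _ fr AN); set j := size L => /=.
have nN : (n < N)%N by apply: leq_ltn_trans AN; exact: leq_addl.
have Zc (c : 'I_N) : n%:R * explore_sum (fun=> 1) (u :: A) (kids u c ++ L) n =
    (j + c)%:R * spine_weight f N 0 n (j + c).
  have fr' := frontier_step c fr.
  by rewrite IH// size_cat size_kids addnC.
have [n0|n0] := posnP n.
  rewrite {}n0 in nN AN Zc *; rewrite mul1r.
  have [L0|L0] := eqVneq L [::]; last first.
    have j0 : (0 < j)%N by rewrite lt0n size_eq0.
    rewrite big1 ?spine_weight_gt ?mulr0// => c _.
    rewrite explore_sum0 ?mulr0//; first exact: frontier_step.
    by rewrite -size_eq0 size_cat -/j; lia.
  have j0 : j = 0%N by rewrite /j L0.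
  case: N nN AN Zc {IH} => // M _ AN Zc; rewrite big_ord_recl big1 => [|c _]; last first.
    rewrite explore_sum0 ?mulr0//; exact: frontier_step.
  have fr0 := frontier_step 0 fr; rewrite /= L0 /kids /= in fr0 *.
  rewrite explore_sum_nil0// addr0 mulr1 mul1r /spine_weight /= expr0 mul1r subn0 expr1.
  by rewrite subnn coef_poly.
have nR : n%:R != 0 :> R by rewrite pnatr_eq0 -lt0n.
apply: (mulfI nR); rewrite mulrCA mulr_sumr.
rewrite (eq_bigr (fun c : 'I_N => j%:R * (f c * spine_weight f N 0 n (j + c)) +
   f c * (c%:R * spine_weight f N 0 n (j + c)))); last first.
  by move=> c _; rewrite mulrCA Zc natrD; ring.
rewrite big_split -mulr_sumr /= spine_weight_rest// spine_weight_child//.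
rewrite mulrDr spine_weight_exchange.
have [jn|nj] := leqP j n; last by rewrite !spine_weight_gt// !mulr0 addr0.
by rewrite natrB// -[n.+1%:R]natr1 -[j.+1%:R]natr1; ring.
Qed.

(** The expected number of unexplored nodes at height at least [h].  A pending node
    [u] contributes the weight of a spine of length [h - size u] above it, because
    by [spine_weight_child] the [c] children of [u] contribute, on average, a spine
    longer by one step; a pending node that is itself high enough adds 1, which
    [explore_total] accounts for. *)
Lemma explore_deep h N n A L : frontier A L -> (size A + n <= N)%N ->
  explore_sum (deep_count h A) A L n =
  \sum_(u <- L) spine_weight f N (h - size u) n (size L).
Proof.
elim: n A L => [|n IH] A [|u L] fr; rewrite ?addnS ?addn0 => AN.
- rewrite explore_sum_nil0// big_nil explored_count// => v; by rewrite inE.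
- by rewrite explore_sum0// big1// => v _; rewrite spine_weight_gt.
- by rewrite explore_sum_nil// big_nil.
have nN : (n < N)%N by apply: leq_ltn_trans AN; exact: leq_addl.
set j := size L.
have -> : explore_sum (deep_count h A) A (u :: L) n.+1 =
    (h <= size u)%N%:R * explore_sum (fun=> 1) A (u :: L) n.+1 +
    explore_sum (deep_count h (u :: A)) A (u :: L) n.+1.
  rewrite /explore_sum mulr_sumr -big_split /=; apply: eq_bigr => t /asboolP[sub _].
  rewrite (deep_count_cons h (u := u)) ?(frontier_notin fr)//; first by ring.
  by apply: sub; rewrite mem_cat inE eqxx orbT.
rewrite (explore_sum_step (deep_count h (u :: A)) fr AN) big_cons.
have Yc (c : 'I_N) : explore_sum (deep_count h (u :: A)) (u :: A) (kids u c ++ L) n =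
    c%:R * spine_weight f N (h - (size u).+1) n (j + c) +
    \sum_(v <- L) spine_weight f N (h - size v) n (j + c).
  have fr' := frontier_step c fr; rewrite IH// big_cat size_cat size_kids (addnC c) /=.
  congr (_ + _); rewrite big_map (eq_bigr (fun=> spine_weight f N (h - (size u).+1) n (j + c))).
    by rewrite big_const_seq count_predT size_iota iter_addr_0 mulr_natl.
  by move=> i _; rewrite size_rcons.
rewrite [\sum_(c < N) _](eq_bigr (fun c : 'I_N =>
  f c * (c%:R * spine_weight f N (h - (size u).+1) n (j + c)) +
  \sum_(v <- L) f c * spine_weight f N (h - size v) n (j + c))); last first.
  by move=> c _; rewrite Yc mulrDr mulr_sumr.
rewrite big_split /= spine_weight_child// addrA; congr (_ + _); last first.
  by rewrite exchange_big /=; apply: eq_bigr => v _; exact: spine_weight_rest.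
case: leqP => [hu|uh]; last by rewrite mul0r add0r subnS prednK// subn_gt0.
rewrite mul1r (_ : h - size u = 0)%N; last by apply/eqP; rewrite subn_eq0.
rewrite (_ : h - (size u).+1 = 0)%N; last by apply/eqP; rewrite subn_eq0 leqW.
have n1 : n.+1%:R != 0 :> R by rewrite pnatr_eq0.
apply: (mulfI n1); rewrite mulrDr (@explore_total N)//; last by rewrite addnS.
rewrite spine_weight_exchange /= -/j.
have [jn|nj] := leqP j n; last by rewrite !spine_weight_gt// !mulr0 addr0.
by rewrite natrB// -[n.+1%:R]natr1 -[j.+1%:R]natr1; ring.
Qed.

Lemma frontier_root : frontier [::] [:: [::]].
Proof.
split=> // [u i|u i j _]; rewrite inE => /eqP E; have := congr1 size E; by rewrite size_rcons.
Qed.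

Definition tree_weight (t : {fset node}) : R := \prod_(v <- t) f (outdegree t v).

Lemma tree_sum_root F n :
  explore_sum F [::] [:: [::]] n =
  \sum_(t <- trees n) tree_weight (nodes t) * F t.
Proof.
rewrite /explore_sum add0n; apply: eq_big => [t|t _]; last first.
  by congr (_ * _); apply: eq_bigl.
apply/asboolP; split=> // v; rewrite inE => /eqP ->.
by have [] := plane_treeP t.
Qed.

(** The cycle lemma [n P(|T| = n) = P(S_n = n - 1)], from the exploration that
    starts with the root pending. *)
Lemma trees_total n : (0 < n)%N ->
  n%:R * \sum_(t <- trees n) tree_weight (nodes t) =
  spine_weight f n 0 n 1.
Proof.
move=> n0; have := @explore_total n n _ _ frontier_root (leqnn n).
rewrite tree_sum_root mul1r => <-; congr (_ * _).
by apply: eq_bigr => t _; rewrite mulr1.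
Qed.

(** Divided by the identity [trees_total], this is the probability that a uniform
    node of [T_n] has height at least [h]. *)
Lemma trees_deep n h :
  \sum_(t <- trees n) tree_weight (nodes t) *
    (\sum_(v <- nodes t) (h <= size v)%N%:R) =
  spine_weight f n h n 1.
Proof.
have := @explore_deep h n n _ _ frontier_root (leqnn n).
rewrite tree_sum_root big_seq1 subn0 => <-; apply: eq_bigr => t _.
by congr (_ * _); apply: eq_bigl.
Qed.

End ExploreSum.

(** * The height of a uniform node has Gaussian tails of any scale *)
Section Estimates.
Variable R : realType.

Lemma expR_beats_cube (kap C : R) : 0 < kap -> 0 < C ->
  exists n0, forall n, (n0 <= n)%N -> (0 < n)%N -> C * expR (- (kap * n%:R)) <= (n%:R ^+ 3)^-1.
Proof.
move=> k0 C0; exists (Num.truncn (24 * C / kap ^+ 4)).+1 => n nn n0.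
have nR : 0 < n%:R :> R by rewrite ltr0n.
have nk : 24 * C / kap ^+ 4 <= n%:R.
  by apply: ltW; apply: lt_le_trans (truncnS_gt _) _; rewrite ler_nat.
rewrite ler_pdivrMr ?exprn_gt0// in nk.
rewrite expRN ler_pdivrMr ?expR_gt0// ler_pdivlMl ?exprn_gt0//.
have := expR_ge1Dxn 3 (x := kap * n%:R) ltac:(rewrite mulr_ge0// ltW//).
apply: le_trans; rewrite (_ : 4`! = 24)%N//.
apply: (@le_trans _ _ ((kap * n%:R) ^+ 4 / 24)); last by rewrite lerDr.
rewrite ler_pdivlMr//.
rewrite [leRHS](_ : _ = n%:R ^+ 3 * (n%:R * kap ^+ 4)); last by ring.
by rewrite -mulrA ler_wpM2l ?exprn_ge0// mulrC.
Qed.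

Lemma one_sub_expRN (x : R) : 0 <= x -> Num.min x 1 / 2 <= 1 - expR (- x).
Proof.
move=> x0; have x1 : 0 < 1 + x by rewrite ltr_pwDl.
have E : expR (- x) <= (1 + x)^-1.
  by rewrite expRN lef_pV2 ?posrE ?expR_gt0// expR_ge1Dx.
apply: (@le_trans _ _ (1 - (1 + x)^-1)); last by rewrite lerD2l lerN2.
rewrite (_ : 1 - (1 + x)^-1 = x / (1 + x)); last by field; rewrite gt_eqF.
rewrite ler_pdivlMr//; case: (leP x 1) => h; nra.
Qed.

(** From [exp(- y^2) <= 1 / (1 + y^2) <= 2 / (1 + y)^2] and a telescoping sum. *)
Lemma gauss_sum (x : R) A : 0 < x ->
  \sum_(a < A) expR (- (x * a%:R) ^+ 2) <= 2 * (1 + x^-1).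
Proof.
move=> x0; have xi : 0 < x^-1 by rewrite invr_gt0.
case: A => [|A]; first by rewrite big_ord0 mulr_ge0// addr_ge0// ltW.
apply: (@le_trans _ _ (2 * (1 + x^-1 - x^-1 / (1 + x * A%:R)))); last first.
  by rewrite ler_wpM2l// gerBl divr_ge0 ?ltW// ltr_pwDl// mulr_ge0// ltW.
elim: A => [|A IH].
  rewrite big_ord_recl big_ord0 mulr0 expr0n oppr0 expR0 !addr0 divr1 addrK mulr1; lra.
rewrite big_ord_recr /=; apply: le_trans (lerD IH (lexx _)) _.
set y := 1 + x * A%:R; set z := 1 + x * A.+1%:R.
have y1 : 1 <= y by rewrite lerDl mulr_ge0// ltW.
have yz : z = y + x by rewrite /y /z -natr1; ring.
have z0 : 0 < z by rewrite yz; lra.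
have E : expR (- (x * A.+1%:R) ^+ 2) <= 2 / z ^+ 2.
  rewrite expRN -[leRHS]invrK lef_pV2 ?posrE ?expR_gt0 ?invr_gt0 ?divr_gt0 ?exprn_gt0//.
  apply: le_trans (expR_ge1Dx _); rewrite invf_div ler_pdivrMr// -subr_ge0.
  rewrite (_ : _ - _ = (1 - x * A.+1%:R) ^+ 2) ?sqr_ge0// /z; ring.
apply: le_trans (lerD (lexx _) E) _.
have zy : 2 / z ^+ 2 <= 2 * (x^-1 / y - x^-1 / z).
  rewrite [leRHS](_ : _ = 2 / (y * z)); last first.
    rewrite yz; field; rewrite -yz !gt_eqF//; lra.
  rewrite ler_wpM2l// lef_pV2 ?posrE ?mulr_gt0 ?exprn_gt0//; last lra.
  by rewrite expr2 ler_wpM2r ?ltW// yz; lra.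
lra.
Qed.

End Estimates.

Section Tail.
Variables (R : realType) (f : nat -> R) (m : R).
Hypothesis f_ge0 : forall c, 0 <= f c.
Hypothesis m_lt1 : m < 1.
Hypothesis mass_le1 : forall N, \sum_(c < N) f c <= 1.
Hypothesis mean_le : forall N, \sum_(c < N) c%:R * f c <= m.
Hypothesis mass1 : forall e, 0 < e -> exists B, 1 - e <= \sum_(c < B) f c.
Hypothesis heavy_tail : forall e N, 0 < e -> exists2 c, (N <= c)%N & expR (- (e * c%:R)) <= f c.
Local Notation sw n h := (spine_weight f n h n 1).

(** The constant [M] is arbitrary because the threshold [K] is: whatever [K], the
    entries above [K] carry a positive proportion of the mass, and [b K >= 2 M]
    makes their effect as strong as wanted.  The light vectors, exponentially rare
    by [spine_weight_tail], stay negligible after conditioning on an event whose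
    probability is not exponentially small. *)
Lemma depth_tail (M : R) : 0 < M -> exists n0, forall n, (n0 <= n)%N -> (0 < n)%N ->
  0 < sw n 0 -> forall a,
  sw n (2 * a) <= sw n 0 * (expR (- (M * a%:R ^+ 2 / n%:R)) + 2 * (n%:R ^+ 3)^-1).
Proof.
move=> M0; have m0 : 0 <= m by have := mean_le 0; rewrite big_ord0.
pose b := (1 - m) / 3.
have b0 : 0 < b by rewrite divr_gt0// subr_gt0.
pose K := (Num.truncn (2 * M / b)).+1.
have bK : 2 * M <= b * K%:R.
  by rewrite [leRHS]mulrC -ler_pdivrMr//; apply: ltW; exact: truncnS_gt.
have KR : 0 < K%:R :> R by rewrite ltr0n.
pose k1 := b ^+ 2 / (2 * K%:R) / 2.
have k10 : 0 < k1 by rewrite !divr_gt0// ?exprn_gt0// mulr_gt0.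
have k20 : 0 < b / (2 * K%:R) by rewrite divr_gt0// mulr_gt0.
have [n1 H1] := spine_weight_subexp f_ge0 m_lt1 mean_le mass1 heavy_tail k10.
have [n2 H2] := expR_beats_cube k10 (expR_gt0 (b / (2 * K%:R))).
have [n3 H3] := expR_beats_cube k20 ltr01.
exists (maxn n1 (maxn n2 n3)) => n; rewrite !geq_max => /and3P[/H1{}H1 /H2{}H2 /H3{}H3].
move=> n0 w0 a; have {}H1 := H1 w0; have {}H2 := H2 n0; have {}H3 := H3 n0.
have nR : 0 < n%:R :> R by rewrite ltr0n.
have [an|na] := leqP (2 * a) n; last first.
  rewrite spine_weight_eq0; last by move: na n0; clear; lia.
  by rewrite mulr_ge0 ?(ltW w0)// addr_ge0 ?expR_ge0// mulr_ge0// invr_ge0 exprn_ge0.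
have := spine_weight_tail f_ge0 m0 m_lt1 (mass_le1 n) (mean_le n) (ltn0Sn _ : 0 < K)%N n0 an.
rewrite -/b => /= /le_trans; apply.
rewrite (_ : 2 * (n%:R ^+ 3)^-1 = (n%:R ^+ 3)^-1 + (n%:R ^+ 3)^-1); last by ring.
rewrite addrA [leRHS]mulrDr lerD//; last first.
  rewrite -expRM_natl; apply: (@le_trans _ _ (expR (- (k1 * n%:R)) * (n%:R ^+ 3)^-1)).
    apply: le_trans (ler_wpM2l (expR_ge0 _) H2).
    rewrite mulrCA ler_wpM2l ?expR_ge0// -expRD ler_expR /k1; lra.
  by rewrite ler_wpM2r ?invr_ge0 ?exprn_ge0.
rewrite ler_wpM2l ?(ltW w0)//.
have x0 : 0 <= a%:R * K%:R / n%:R :> R by rewrite divr_ge0// mulr_ge0.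
have := one_sub_expRN x0; have [x1|x1] := leP (a%:R * K%:R / n%:R) 1 => hx.
  apply: ler_wpDr; first by rewrite invr_ge0 exprn_ge0.
  rewrite ler_expR lerN2.
  apply: (@le_trans _ _ (a%:R * (b * (a%:R * K%:R / n%:R / 2)))); last first.
    by rewrite ler_wpM2l// ler_wpM2l// ltW.
  rewrite ler_pdivrMr//.
  rewrite (_ : _ * n%:R = a%:R ^+ 2 * (b * K%:R / 2)); last by field; rewrite gt_eqF.
  rewrite mulrC ler_wpM2l ?exprn_ge0//; lra.
apply: ler_wpDl; first exact: expR_ge0.
apply: le_trans H3; rewrite mul1r ler_expR lerN2.
apply: (@le_trans _ _ (a%:R * (b * (1 / 2)))); last by rewrite ler_wpM2l// ler_wpM2l// ltW.
rewrite ltr_pdivlMr// mul1r in x1.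
rewrite (_ : _ * n%:R = b / 2 * (n%:R / K%:R)); last by field; rewrite gt_eqF.
rewrite (_ : a%:R * _ = b / 2 * a%:R); last by ring.
have nK : n%:R / K%:R <= a%:R :> R by rewrite ler_pdivrMr// ltW.
by rewrite ler_wpM2l// ltW// divr_gt0.
Qed.

End Tail.

(** * Averages over random trees *)
Lemma size_le_height (t : plane_tree) v : v \in nodes t -> (size v <= height t)%N.
Proof. by move=> vt; exact: (@leq_bigmax_seq _ (enum_fset (nodes t)) xpredT size v vt isT). Qed.

Lemma height_lt (t : plane_tree) : (height t < #|` nodes t|)%N.
Proof.
have [rt _ _] := plane_treeP t.
have n0 : (0 < #|` nodes t|)%N by apply: leq_ltn_trans (node_size_lt rt).
rewrite -(prednK n0) ltnS; apply/bigmax_leqP_seq => v vt _.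
by rewrite -ltnS prednK// node_size_lt.
Qed.

Lemma level_le_width (t : plane_tree) k : (#|` level t k| <= width t)%N.
Proof.
have [kh|hk] := leqP k (height t).
  by rewrite /width (leq_bigmax (F := fun k : 'I_(height t).+1 => #|` level t k|) (Ordinal (kh : k < (height t).+1)%N)).
rewrite (_ : level t k = fset0) ?cardfs0//; apply/fsetP => v; rewrite !inE /=.
by apply/negP => /andP[/size_le_height vh /eqP vk]; move: hk; rewrite -vk ltnNge vh.
Qed.

(** The nodes below height [h] fill [h] levels. *)
Lemma sum_shallow_le (t : plane_tree) h :
  (\sum_(v <- nodes t) (size v < h)%N <= h * width t)%N.
Proof.
rewrite (eq_bigr (fun v : node => (\sum_(k < h) (size v == k))%N)); last first.
  move=> v _; have [vh|hv] := ltnP (size v) h.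
    rewrite (bigD1 (Ordinal vh))//= eqxx big1 ?addn0// => i; rewrite -val_eqE /= eq_sym.
    by move/negbTE => ->.
  by rewrite big1// => i _; case: eqP => // E; move: hv; rewrite leqNgt E ltn_ord.
rewrite exchange_big /= -[h in (h * _)%N]card_ord -sum_nat_const leq_sum// => k _.
apply: leq_trans (level_le_width t k).
rewrite (eq_bigr (fun v : node => if (size v == k)%N then 1%N else 0%N)); last first.
  by move=> v _; case: eqP.
rewrite -big_mkcond sum1_count -size_filter; apply: uniq_leq_size.
  by rewrite filter_uniq ?fset_uniq.
by move=> v; rewrite mem_filter !inE /= andbC.
Qed.

(** Allows summing the tail only over even heights, where [depth_tail] applies. *)
Lemma leq_double_sum n x : (x < n)%N -> (x <= 2 * \sum_(a < n) (2 * a <= x))%N.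
Proof.
move=> xn; suff : (minn (2 * n) x <= 2 * \sum_(a < n) (2 * a <= x))%N by lia.
elim: n {xn} => [|n IH]; first by rewrite big_ord0; lia.
rewrite big_ord_recr /=; move: IH; set S := \sum_(_ < _) _; case: leqP; lia.
Qed.

Section TreeMeans.
Variables (R : realType) (f : nat -> R).
Hypothesis f_ge0 : forall c, 0 <= f c.
Local Notation sw n h := (spine_weight f n h n 1).

(** The mean of [phi T_n V_n]: dividing by [P(S_n = n - 1)] conditions on the size
    and chooses a node uniformly at once, by [trees_total]. *)
Definition node_mean n (phi : plane_tree -> node -> R) : R :=
  (\sum_(t <- trees n) tree_weight f (nodes t) * \sum_(v <- nodes t) phi t v) / sw n 0.

Lemma tree_weight_ge0 t : 0 <= tree_weight f t.
Proof. exact: prodr_ge0. Qed.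

Section Size.
Variable n : nat.
Hypothesis n_gt0 : (0 < n)%N.
Hypothesis w_gt0 : 0 < sw n 0.

Lemma node_mean_le (phi psi : plane_tree -> node -> R) :
  (forall t v, #|` nodes t| = n -> v \in nodes t -> phi t v <= psi t v) ->
  node_mean n phi <= node_mean n psi.
Proof.
move=> le; rewrite /node_mean ler_wpM2r ?invr_ge0 ?(ltW w_gt0)// big_seq [leRHS]big_seq.
apply: ler_sum => t; rewrite mem_trees => /eqP tn.
rewrite ler_wpM2l ?tree_weight_ge0// big_seq [leRHS]big_seq.
by apply: ler_sum => v vt; exact: le.
Qed.

Lemma node_mean_ge0 (phi : plane_tree -> node -> R) :
  (forall t v, 0 <= phi t v) -> 0 <= node_mean n phi.
Proof.
move=> phi0; apply: divr_ge0; last exact: ltW.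
by apply: sumr_ge0 => t _; rewrite mulr_ge0 ?tree_weight_ge0// sumr_ge0.
Qed.

Lemma node_meanD phi psi :
  node_mean n (fun t v => phi t v + psi t v) = node_mean n phi + node_mean n psi.
Proof.
rewrite /node_mean -mulrDl -big_split; congr (_ / _); apply: eq_bigr => t _ /=.
by rewrite big_split mulrDr.
Qed.

Lemma node_meanZ c phi : node_mean n (fun t v => c * phi t v) = c * node_mean n phi.
Proof.
rewrite /node_mean mulrA mulr_sumr; congr (_ / _); apply: eq_bigr => t _ /=.
by rewrite -mulr_sumr mulrCA.
Qed.

Lemma node_mean_sum k (phi : nat -> plane_tree -> node -> R) :
  node_mean n (fun t v => \sum_(i < k) phi i t v) = \sum_(i < k) node_mean n (phi i).
Proof.
rewrite /node_mean -mulr_suml exchange_big; congr (_ / _); apply: eq_bigr => t _ /=.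
by rewrite exchange_big mulr_sumr.
Qed.

Lemma node_mean_tree g :
  node_mean n (fun t _ => g t) =
  n%:R * (\sum_(t <- trees n) tree_weight f (nodes t) * g t) / sw n 0.
Proof.
rewrite /node_mean mulr_sumr; congr (_ / _).
rewrite big_seq [RHS]big_seq; apply: eq_bigr => t; rewrite mem_trees => /eqP tn.
by rewrite big_const_seq count_predT iter_addr_0 -[X in _ *+ X]/(#|` nodes t|) tn mulrCA mulr_natl.
Qed.

Lemma node_mean_cst c : node_mean n (fun _ _ => c) = c.
Proof.
rewrite node_mean_tree -mulr_suml mulrA (trees_total f n_gt0).
by rewrite mulrAC divff ?mul1r// gt_eqF.
Qed.

Lemma node_mean_tree_sum phi :
  node_mean n (fun t _ => \sum_(v <- nodes t) phi t v) = n%:R * node_mean n phi.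
Proof. by rewrite node_mean_tree -mulrA. Qed.

Lemma node_mean_deep h :
  node_mean n (fun _ v => (h <= size v)%N%:R) = sw n h / sw n 0.
Proof. by rewrite /node_mean trees_deep. Qed.

End Size.

Variable m : R.
Hypothesis m_lt1 : m < 1.
Hypothesis mass_le1 : forall N, \sum_(c < N) f c <= 1.
Hypothesis mean_le : forall N, \sum_(c < N) c%:R * f c <= m.
Hypothesis mass1 : forall e, 0 < e -> exists B, 1 - e <= \sum_(c < B) f c.
Hypothesis heavy_tail : forall e N, 0 < e -> exists2 c, (N <= c)%N & expR (- (e * c%:R)) <= f c.

Lemma node_mean_tail (M : R) : 0 < M -> exists n0, forall n, (n0 <= n)%N -> (0 < n)%N ->
  0 < sw n 0 -> forall a, node_mean n (fun _ v => (2 * a <= size v)%N%:R) <=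
  expR (- (M * a%:R ^+ 2 / n%:R)) + 2 * (n%:R ^+ 3)^-1.
Proof.
move=> M0; have [n0 H] := depth_tail f_ge0 m_lt1 mass_le1 mean_le mass1 heavy_tail M0.
exists n0 => n nn n1 w0 a; rewrite node_mean_deep ler_pdivrMr// mulrC.
exact: H.
Qed.

(** Summing the tail over all heights gives a mean of order [sqrt (n / M)]; with
    [M = (8 / e)^2] it is at most [e sqrt n / 2], up to a constant. *)
Lemma mean_depth_small (e : R) : 0 < e -> exists n0, forall n, (n0 <= n)%N -> (0 < n)%N ->
  0 < sw n 0 -> node_mean n (fun _ v => (size v)%:R / Num.sqrt n%:R) <= e.
Proof.
move=> e0; have M0 : 0 < (8 / e) ^+ 2 by rewrite exprn_gt0// divr_gt0.
have [n1 H] := node_mean_tail M0.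
exists (maxn n1 (Num.truncn ((16 / e) ^+ 2)).+1) => n.
rewrite geq_max => /andP[/H{}H nn] n0 w0; have {}H := H n0 w0.
have nR : 1 <= n%:R :> R by rewrite ler1n.
have n_0 : 0 < n%:R :> R by lra.
pose s := Num.sqrt (n%:R : R).
have s0 : 0 < s by rewrite sqrtr_gt0.
have s2 : s ^+ 2 = n%:R by rewrite sqr_sqrtr// ltW.
have se : 16 <= e * s.
  rewrite mulrC -ler_pdivrMr//.
  apply: (@le_trans _ _ (Num.sqrt ((16 / e) ^+ 2))); first by rewrite sqrtr_sqr ler_norm.
  apply: ler_wsqrtr.
  by apply: ltW; apply: lt_le_trans (truncnS_gt _) _; rewrite ler_nat.
have -> : node_mean n (fun _ v => (size v)%:R / s) = s^-1 * node_mean n (fun _ v => (size v)%:R).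
  by rewrite -node_meanZ; apply: congr1; apply/funext => t; apply/funext => v; rewrite mulrC.
rewrite ler_pdivrMl//.
pose psi (a : nat) (t : plane_tree) (v : node) : R := (2 * a <= size v)%N%:R.
apply: (@le_trans _ _ (2 * \sum_(a < n) node_mean n (psi a))).
  rewrite -node_mean_sum -node_meanZ; apply: node_mean_le => // t v tn vt.
  rewrite /psi -natr_sum -natrM ler_nat leq_double_sum// -tn; exact: node_size_lt.
have x0 : 0 < 8 / e / s by rewrite !divr_gt0.
have G := gauss_sum n x0.
apply: (@le_trans _ _ (2 * (\sum_(a < n) (expR (- (8 / e / s * a%:R) ^+ 2) + 2 * (n%:R ^+ 3)^-1)))).
  rewrite ler_wpM2l// ler_sum// => a _; apply: le_trans (H a) _.
  rewrite (_ : (8 / e / s * a%:R) ^+ 2 = (8 / e) ^+ 2 * a%:R ^+ 2 / n%:R)//.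
  by rewrite -s2; field; rewrite !gt_eqF.
rewrite big_split /= sumr_const card_ord.
have n3 : (2 * (n%:R ^+ 3)^-1) *+ n <= 2 :> R.
  rewrite -mulr_natr -mulrA ler_piMr// mulrC ler_pdivrMr ?exprn_gt0// mul1r.
  by rewrite -[leLHS]expr1 ler_weXn2l.
have xi : (8 / e / s)^-1 = s * e / 8 by rewrite !invf_div mulrA.
rewrite xi in G; move: G n3 se; set A := \sum_(_ < _) _; set B := _ *+ n; lra.
Qed.

(** At height [2 a] with [a] close to [sqrt n * ln n], the tail of a uniform node is
    at most [3 / n^3], so the expected number of nodes above this height is
    negligible even after multiplication by the largest possible height [n]. *)
Lemma mean_height_small (e : R) : 0 < e -> exists n0, forall n, (n0 <= n)%N -> (0 < n)%N ->
  0 < sw n 0 ->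
  node_mean n (fun t _ => (height t)%:R / (Num.sqrt n%:R * ln n%:R ^+ 3)) <= e.
Proof.
move=> e0; have [n1 H] := node_mean_tail ltr01.
pose X := 3 + 7 / e.
have X3 : 3 <= X by rewrite lerDl divr_ge0// ltW.
exists (maxn n1 (Num.truncn (expR X)).+1) => n.
rewrite geq_max => /andP[/H{}H nn] n0 w0; have {}H := H n0 w0.
have nR : 1 <= n%:R :> R by rewrite ler1n.
have n_0 : 0 < n%:R :> R by lra.
pose s := Num.sqrt (n%:R : R); pose L := ln (n%:R : R).
have s1 : 1 <= s by rewrite -[leLHS]sqrtr1 ler_wsqrtr.
have s0 : 0 < s by lra.
have s2 : s ^+ 2 = n%:R by rewrite sqr_sqrtr// ltW.
have LX : X <= L.
  rewrite -[X]expRK ler_ln ?posrE ?expR_gt0//.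
  by apply: ltW; apply: lt_le_trans (truncnS_gt _) _; rewrite ler_nat.
have L3 : 3 <= L by lra.
have eL : 7 <= e * L.
  rewrite mulrC -ler_pdivrMr//; move: LX; rewrite /X; lra.
pose a := (Num.truncn (s * L)).+1.
have aLo : s * L <= a%:R by apply: ltW; exact: truncnS_gt.
have aHi : a%:R <= s * L + 1.
  rewrite -natr1 lerD2r truncn_le//; apply: mulr_ge0; lra.
have T : node_mean n (fun _ v => (2 * a <= size v)%N%:R) <= 3 * (n%:R ^+ 3)^-1.
  apply: le_trans (H a) _; rewrite mul1r.
  have cube : expR (- (a%:R ^+ 2 / n%:R)) <= (n%:R ^+ 3)^-1 :> R.
    apply: (@le_trans _ _ (expR (- (3 * L)))); last by rewrite expRN expRM_natl lnK// posrE.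
    rewrite ler_expR lerN2 ler_pdivlMr// -s2.
    apply: (@le_trans _ _ ((s * L) ^+ 2)).
      rewrite exprMn mulrC ler_wpM2l ?exprn_ge0 ?(ltW s0)// expr2 ler_wpM2r//; lra.
    rewrite lerXn2r ?nnegrE ?mulr_ge0//; lra.
  rewrite [leRHS](_ : _ = (n%:R ^+ 3)^-1 + 2 * (n%:R ^+ 3)^-1); last by ring.
  by rewrite lerD2r.
have -> : node_mean n (fun t _ => (height t)%:R / (s * L ^+ 3)) =
    (s * L ^+ 3)^-1 * node_mean n (fun t _ => (height t)%:R).
  by rewrite -node_meanZ; apply: congr1; apply/funext => t; apply/funext => v; rewrite mulrC.
have sL0 : 0 < s * L ^+ 3 by rewrite mulr_gt0// exprn_gt0//; lra.
rewrite ler_pdivrMl//.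
pose phi (t : plane_tree) (v : node) : R := (2 * a <= size v)%N%:R.
apply: (@le_trans _ _ (node_mean n (fun t _ => (2 * a)%:R + n%:R * \sum_(v <- nodes t) phi t v))).
  apply: node_mean_le => // t v tn _; rewrite /phi -natr_sum -natrM -natrD ler_nat.
  have [ht|th] := ltnP (height t) (2 * a); first by rewrite ltnW// ltn_addr.
  apply: (@leq_trans n); first by rewrite ltnW// -tn height_lt.
  apply: leq_trans (leq_addl _ _); apply: leq_pmulr.
  rewrite lt0n; apply: contraTneq th => S0; rewrite -ltnNge.
  have a0 : (0 < 2 * a)%N by [].
  rewrite -(prednK a0) ltnS; apply/bigmax_leqP_seq => u ut _.
  rewrite -ltnS prednK// ltnNge; apply/negP => av.
  by move: S0; rewrite (bigD1_seq u) ?fset_uniq//= av.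
rewrite node_meanD node_meanZ node_mean_tree_sum node_mean_cst//.
apply: (@le_trans _ _ (2 * (s * L + 1) + n%:R * (n%:R * (3 * (n%:R ^+ 3)^-1)))).
  rewrite natrM lerD// ler_wpM2l// ler_wpM2l//.
have -> : n%:R * (n%:R * (3 * (n%:R ^+ 3)^-1)) = 3 / n%:R :> R.
  by field; rewrite gt_eqF.
have n3 : 3 / n%:R <= 3 :> R by rewrite ler_pdivrMr//; lra.
have sL : 1 <= s * L by rewrite -[leLHS]mulr1 ler_pM//; lra.
apply: (@le_trans _ _ (7 * (s * L))); first lra.
rewrite (_ : _ * e = (e * L) * (s * L) * L); last by ring.
rewrite -[leLHS]mulr1 ler_pM//; [lra|rewrite ler_pM//; lra|lra].
Qed.

(** A tree of width less than [K sqrt n] has at most [n / 2] nodes below height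
    [h], of order [sqrt n / (4 K)], so at least half of its nodes are higher; this
    is unlikely because a uniform node has mean height [o(sqrt n)]. *)
Lemma thin_unlikely (K e : R) : 0 < K -> 0 < e -> exists n0, forall n, (n0 <= n)%N ->
  (0 < n)%N -> 0 < sw n 0 ->
  node_mean n (fun t _ => ((width t)%:R / Num.sqrt n%:R < K)%R%:R) <= e.
Proof.
move=> K0 e0; have e8 : 0 < e / (8 * K) by rewrite divr_gt0// mulr_gt0.
have [n1 H] := mean_depth_small e8.
exists (maxn n1 (Num.truncn ((4 * K) ^+ 2)).+1) => n.
rewrite geq_max => /andP[/H{}H nn] n0 w0; have {}H := H n0 w0.
have nR : 1 <= n%:R :> R by rewrite ler1n.
have n_0 : 0 < n%:R :> R by lra.
pose s := Num.sqrt (n%:R : R).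
have s0 : 0 < s by rewrite sqrtr_gt0.
have s2 : s ^+ 2 = n%:R by rewrite sqr_sqrtr// ltW.
have sK : 4 * K <= s.
  apply: (@le_trans _ _ (Num.sqrt ((4 * K) ^+ 2))); first by rewrite sqrtr_sqr ler_norm.
  apply: ler_wsqrtr.
  by apply: ltW; apply: lt_le_trans (truncnS_gt _) _; rewrite ler_nat.
pose h := (Num.truncn (s / (4 * K))).+1.
have hLo : s / (4 * K) <= h%:R by apply: ltW; exact: truncnS_gt.
have hHi : h%:R <= s / (4 * K) + 1.
  by rewrite -(natr1 (Num.truncn _)) lerD2r truncn_le// divr_ge0 ?mulr_ge0// ltW.
pose phi (t : plane_tree) (v : node) : R := (h <= size v)%N%:R.
apply: (@le_trans _ _ (node_mean n (fun t _ => 2 / n%:R * \sum_(v <- nodes t) phi t v))).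
  apply: node_mean_le => // t _ tn _; have [thin|_] := ltP; last first.
    by rewrite mulr_ge0 ?divr_ge0// sumr_ge0.
  rewrite ltr_pdivrMr// in thin.
  rewrite mulrAC ler_pdivlMr// mul1r.
  have E : (\sum_(v <- nodes t) (size v < h) + \sum_(v <- nodes t) (h <= size v))%N = n.
    rewrite -big_split /= -tn; transitivity (\sum_(v <- nodes t) 1)%N; last exact: sum1_size.
    by apply: eq_bigr => v _; case: ltnP.
  have S := sum_shallow_le t h.
  have : (\sum_(v <- nodes t) (size v < h)%N)%:R <= n%:R / 2 :> R.
    apply: (@le_trans _ _ (h%:R * (K * s))).
      apply: (@le_trans _ _ (h * width t)%:R); first by rewrite ler_nat.
      by rewrite natrM ler_wpM2l// ltW.
    apply: (@le_trans _ _ ((s / (4 * K) + 1) * (K * s))).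
      by rewrite ler_wpM2r// mulr_ge0// ltW.
    rewrite -s2 (_ : _ * (K * s) = s ^+ 2 / 4 + K * s); last by field; rewrite gt_eqF.
    nra.
  rewrite /phi -natr_sum; move: E => /(congr1 (fun k => k%:R : R)); rewrite natrD; lra.
rewrite node_meanZ node_mean_tree_sum mulrA divfK ?gt_eqF//.
have hR : 0 < h%:R :> R by rewrite ltr0n.
apply: (@le_trans _ _ (2 * node_mean n (fun _ v => s / h%:R * ((size v)%:R / s)))).
  rewrite ler_wpM2l//; apply: node_mean_le => // t v _ _; rewrite /phi.
  rewrite [leRHS](_ : _ = (size v)%:R / h%:R); last by field; rewrite !gt_eqF.
  by case: leqP => hv; rewrite ?divr_ge0// ler_pdivlMr// mul1r ler_nat.
rewrite node_meanZ.
apply: (@le_trans _ _ (2 * (4 * K * (e / (8 * K))))).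
  rewrite ler_wpM2l//; apply: ler_pM => //.
  - by rewrite divr_ge0// ltW.
  - rewrite -(node_mean_cst n0 w0 0); apply: node_mean_le => // t v _ _.
    by rewrite divr_ge0// ltW.
  - rewrite ler_pdivrMr// mulrC -ler_pdivrMr//; by rewrite mulr_gt0.
by rewrite le_eqVlt; apply/orP; left; apply/eqP; field; rewrite gt_eqF.
Qed.

Lemma fat_likely (K e : R) : 0 < e -> exists n0, forall n, (n0 <= n)%N ->
  (0 < n)%N -> 0 < sw n 0 ->
  1 - e <= node_mean n (fun t _ => (K <= (width t)%:R / Num.sqrt n%:R)%R%:R).
Proof.
move=> e0; have K0 : 0 < Num.max K 1 by rewrite lt_max ltr01 orbT.
have [n0 H] := thin_unlikely K0 e0; exists n0 => n nn n1 w0.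
rewrite lerBlDl; apply: le_trans (lerD (H n nn n1 w0) (lexx _)).
rewrite -node_meanD -[leLHS](node_mean_cst n1 w0); apply: node_mean_le => // t v _ _.
by rewrite lt_max orbC; case: (leP K) => _; rewrite ?orbT ?addr0 ?lerDr.
Qed.

End TreeMeans.

(** * Random variables with countably many values *)

(** If the given probabilities of finitely many values of [Y] add up to 1, then
    they determine expectations, although the other values may occur on a null
    set. *)
Section Discrete.
Variables (R : realType) (d : measure_display) (Omega : measurableType d).
Variables (P : probability Omega R) (C : countType) (Y : Omega -> C).
Hypothesis mY : forall y, measurable [set w | Y w = y].

Lemma measurable_discrete (A : set C) : measurable (Y @^-1` A).
Proof.
have -> : Y @^-1` A = \bigcup_y ([set w | Y w = y /\ A y]).
  by apply/seteqP; split=> [w /= Aw|w [y _ /= [-> //]]]; exists (Y w).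
apply: countable_bigcupT_measurable => [|y]; first exact: countableP.
have [Ay|nAy] := pselect (A y).
  by rewrite (_ : [set w | _] = [set w | Y w = y])//; apply/seteqP; split=> [w []|w].
by rewrite (_ : [set w | _] = set0)//; apply/seteqP; split=> [w []|w].
Qed.

Lemma measurable_fun_discrete (g : C -> R) : measurable_fun setT (g \o Y).
Proof. by move=> _ B mB; rewrite setTI; exact: (measurable_discrete (g @^-1` B)). Qed.

Variables (G : seq C) (p : C -> R).
Hypothesis uniqG : uniq G.
Hypothesis pP : forall y, y \in G -> P [set w | Y w = y] = (p y)%:E.
Hypothesis p1 : \sum_(y <- G) p y = 1.

Lemma discrete_ae : P (Y @^-1` [set y | y \notin G]) = 0%E.
Proof.
have -> : Y @^-1` [set y | y \notin G] = ~` (\bigcup_(y in [set` G]) [set w | Y w = y]).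
  apply/seteqP; split=> w /=; first by move=> /negP nG [y /= yG Yy]; apply: nG; rewrite Yy.
  by move=> nG; apply/negP => YG; apply: nG; exists (Y w).
have fG : finite_set [set` G] by exact: finite_seq.
rewrite probability_setC; last by apply: fin_bigcup_measurable => // y _; exact: mY.
rewrite measure_fin_bigcup//; last first.
  by move=> x y _ _ [w [/= <- <-]].
rewrite -fsbig_seq// (eq_big_seq (fun y => (p y)%:E)) => [|y yG]; last exact: pP.
by rewrite sumEFin p1 subee.
Qed.

Lemma expectation_discrete (g : C -> R) : (forall y, 0 <= g y) ->
  ('E_P[g \o Y] = (\sum_(y <- G) g y * p y)%:E)%E.
Proof.
move=> g0; rewrite unlock.
pose h w := (\sum_(y <- G) (g y)%:E * (\1_[set w | Y w = y] w)%:E)%E.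
have mind y : measurable_fun setT (EFin \o (\1_[set w | Y w = y] : Omega -> R)).
  by apply/measurable_EFinP; exact: measurable_indic.
have mterm y : measurable_fun setT (fun w => (g y)%:E * (\1_[set w | Y w = y] w)%:E)%E.
  by apply: measurable_funeM; exact: mind.
have t0 y w : (0 <= (g y)%:E * (\1_[set w | Y w = y] w)%:E)%E.
  by rewrite mule_ge0// lee_fin// g0.
rewrite (@ge0_ae_eq_integral _ _ _ _ _ _ h)//.
- rewrite /h ge0_integral_sum//.
  rewrite (eq_big_seq (fun y => (g y * p y)%:E)) ?sumEFin// => y yG.
  rewrite ge0_integralZl//; last by rewrite lee_fin.
  rewrite integral_indic//.
  by rewrite setIT EFinM; congr (_ * _)%E; exact: pP.
  exact: mind.
- by apply/measurable_EFinP; exact: measurable_fun_discrete.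
- by rewrite /h; apply: emeasurable_sum.
- by move=> w _; rewrite lee_fin /= g0.
- by move=> w _; apply: sume_ge0 => y _.
exists (Y @^-1` [set y | y \notin G]); split; first exact: measurable_discrete.
  exact: discrete_ae.
move=> w /= ne; apply/negP => YG; apply: ne => _.
rewrite /h (bigD1_seq (Y w))//= indicE mem_set//= mule1 big1 ?adde0// => y yY.
by rewrite indicE memNset ?mule0//= => Yy; move: yY; rewrite Yy eqxx.
Qed.

Lemma probability_discrete (Q : pred C) :
  P [set w | Q (Y w)] = (\sum_(y <- G) (Q y)%:R * p y)%:E.
Proof.
rewrite -(expectation_discrete (g := fun y => (Q y)%:R))// unlock.
rewrite (_ : (fun w => _) = (fun w => (\1_[set w | Q (Y w)] w)%:E)); last first.
  apply/funext => w; rewrite indicE /=; case q : (Q (Y w)); first by rewrite mem_set.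
  by rewrite memNset//= q.
by rewrite integral_indic ?setIT//; exact: (measurable_discrete [set y | Q y]).
Qed.

End Discrete.

(** * The offspring distribution *)
Section Offspring.
Variables (R : realType) (mu : probability nat R).
Hypothesis mu_subcritical : (moment_norm mu 1 < 1)%E.
Hypothesis mu_heavy : forall t : R, 0 < t ->
    (\sum_(0 <= c <oo) (expR (t * c%:R))%:E * mu [set c] = +oo)%E.

Definition pmf c : R := fine (mu [set c]).

Lemma pmfE c : mu [set c] = (pmf c)%:E.
Proof. by rewrite fineK// fin_num_measure. Qed.

Lemma pmf_ge0 c : 0 <= pmf c.
Proof. exact: fine_ge0. Qed.

Lemma pmf_series : (\sum_(0 <= c <oo) (pmf c)%:E = 1)%E.
Proof.
have <- : mu setT = 1%E by exact: probability_setT.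
have -> : [set: nat] = \bigcup_c [set c].
  by apply/seteqP; split=> // c _; exists c.
rewrite measure_semi_bigcup//; last by move=> x y _ _ [w [/= <- <-]].
by apply: eq_eseriesr => c _; rewrite -pmfE.
Qed.

Lemma pmf_mass_le1 N : \sum_(c < N) pmf c <= 1.
Proof.
rewrite -lee_fin -sumEFin -(big_mkord xpredT (fun c => (pmf c)%:E)) -pmf_series.
by apply: nneseries_lim_ge => c _ _; rewrite lee_fin pmf_ge0.
Qed.

Lemma pmf_mass1 e : 0 < e -> exists B, 1 - e <= \sum_(c < B) pmf c.
Proof.
move=> e0; have [//|no] := pselect (exists B, 1 - e <= \sum_(c < B) pmf c).
have : (\sum_(0 <= c <oo) (pmf c)%:E <= (1 - e)%:E)%E.
  apply: lime_le.
    by apply: is_cvg_nneseries => c _ _; rewrite lee_fin pmf_ge0.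
  apply: nearW => B; rewrite big_mkord sumEFin lee_fin leNgt; apply/negP => /ltW h.
  by apply: no; exists B.
by rewrite pmf_series lee_fin leNgt ltrBlDr ltrDl e0.
Qed.

Lemma pmf_mean : exists2 m : R, m < 1 & forall N, \sum_(c < N) c%:R * pmf c <= m.
Proof.
pose S := (\sum_(0 <= c <oo) (c%:R * pmf c)%:E)%E.
have nn c : (0 <= (c%:R * pmf c)%:E)%E by rewrite lee_fin mulr_ge0 ?pmf_ge0.
have S0 : (0 <= S)%E by apply: nneseries_ge0.
have S1 : (S < 1)%E.
  move: mu_subcritical; rewrite /moment_norm invr1.
  rewrite (_ : (\sum_(0 <= c <oo) _)%E = S) ?poweRe1//.
  by apply: eq_eseriesr => c _; rewrite powRr1// pmfE EFinM.
have Sf : S \is a fin_num by rewrite ge0_fin_numE// (lt_trans S1) ?ltry.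
exists (fine S); first by rewrite -lte_fin fineK.
move=> N; rewrite -lee_fin fineK// -sumEFin -(big_mkord xpredT (fun c => (c%:R * pmf c)%:E)).
exact: nneseries_lim_ge.
Qed.

Lemma geometric_sum_le (r : R) N : 0 <= r -> r < 1 -> \sum_(i < N) r ^+ i <= (1 - r)^-1.
Proof.
move=> r0 r1; have p : 0 < 1 - r by rewrite subr_gt0.
rewrite -[leRHS]mul1r ler_pdivlMr// mulrC -opprB mulNr -subrX1 opprB gerBl exprn_ge0//.
Qed.

(** Otherwise [f(c) < exp(- e c)] for all large [c], and the exponential moment of
    order [e / 2] is finite. *)
Lemma pmf_heavy e N : 0 < e -> exists2 c, (N <= c)%N & expR (- (e * c%:R)) <= pmf c.
Proof.
move=> e0; have [//|no] := pselect (exists2 c, (N <= c)%N & expR (- (e * c%:R)) <= pmf c).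
have lt c : (N <= c)%N -> pmf c < expR (- (e * c%:R)).
  by move=> Nc; rewrite ltNge; apply/negP => ?; apply: no; exists c.
have e2 : 0 < e / 2 by rewrite divr_gt0.
pose r := expR (- (e / 2)).
pose A := \sum_(c < N) expR (e / 2 * c%:R).
have bound k : \sum_(c < k) expR (e / 2 * c%:R) * pmf c <= A + (1 - r)^-1.
  apply: (@le_trans _ _ (\sum_(c < k) ((if (c < N)%N then expR (e / 2 * c%:R) else 0) + r ^+ c))).
    apply: ler_sum => c _; case: ltnP => [cN|Nc].
      apply: (@le_trans _ _ (expR (e / 2 * c%:R))); last by rewrite lerDl exprn_ge0// expR_ge0.
      rewrite ler_piMr ?expR_ge0//; apply: le_trans (pmf_mass_le1 c.+1).
      by rewrite big_ord_recr /= lerDr sumr_ge0// => i _; exact: pmf_ge0.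
    rewrite add0r; apply: (@le_trans _ _ (expR (e / 2 * c%:R) * expR (- (e * c%:R)))).
      by rewrite ler_wpM2l ?expR_ge0// ltW// lt.
    by rewrite -expRD -expRM_natl ler_expR; lra.
  rewrite big_split lerD//=; last by rewrite geometric_sum_le ?expR_ge0// expR_lt1 oppr_lt0.
  rewrite -(big_mkord xpredT (fun c => if (c < N)%N then expR (e / 2 * c%:R) else 0)).
  apply: (@le_trans _ _ (\sum_(0 <= c < maxn k N) if (c < N)%N then expR (e / 2 * c%:R) else 0)).
    rewrite [leRHS](big_cat_nat (n := k))//= ?leq_maxl// lerDl sumr_ge0// => c _.
    by case: ifP => // _; exact: expR_ge0.
  rewrite (big_cat_nat (n := N))//= ?leq_maxr// [X in _ + X]big_nat_cond [X in _ + X]big1 ?addr0.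
    by rewrite /A -(big_mkord xpredT (fun c => expR (e / 2 * c%:R))) ler_sum_nat// => c /andP[_ ->].
  by move=> c /andP[/andP[Nc _] _]; rewrite ltnNge Nc.
have : (\sum_(0 <= c <oo) (expR (e / 2 * c%:R))%:E * mu [set c] <= (A + (1 - r)^-1)%:E)%E.
  apply: lime_le.
    by apply: is_cvg_nneseries => c _ _; rewrite mule_ge0// lee_fin expR_ge0.
  apply: nearW => k; rewrite big_mkord (eq_bigr (fun c : 'I_k => (expR (e / 2 * c%:R) * pmf c)%:E)).
    by rewrite sumEFin lee_fin bound.
  by move=> c _; rewrite pmfE EFinM.
by rewrite mu_heavy// leye_eq.
Qed.

End Offspring.

(** * The law of the conditioned tree and of its uniform node *)
Lemma family_tree_root b : family_tree b [::].
Proof. by move=> w i; rewrite prefixs0 -size_eq0 size_rcons. Qed.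

Lemma family_tree_rcons b u i :
  family_tree b (rcons u i) <-> family_tree b u /\ (i < b u)%N.
Proof.
split=> [H|[Hu ib] w k].
  split; last by apply: H; exact: prefix_refl.
  by move=> w k wu; apply: H; rewrite prefix_rconsE wu orbT.
by rewrite prefix_rconsE => /orP[/eqP/rcons_inj[-> ->]//|]; exact: Hu.
Qed.

Lemma family_tree_ulam_harris b (X : {fset node}) :
  family_tree b = [set` X] -> ulam_harris X.
Proof.
move=> E; have memE u : u \in X <-> family_tree b u by rewrite E.
split; first by apply/memE; exact: family_tree_root.
  by move=> u i /memE/family_tree_rcons[/memE].
move=> u i j ij /memE/family_tree_rcons[ut jb]; apply/memE/family_tree_rcons.
by split=> //; exact: ltn_trans jb.
Qed.

(** The event that the family tree equals [t] constrains the offspring numbers of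
    the nodes of [t] only, so its probability is a finite product. *)
Lemma family_tree_eq b (t : {fset node}) : ulam_harris t ->
  family_tree b = [set` t] <-> forall u, u \in t -> b u = outdegree t u.
Proof.
move=> tU; have [rt par _] := tU; split=> [E u ut|H].
  have memE v : v \in t <-> family_tree b v by rewrite E.
  have d i : (i < b u)%N = (i < outdegree t u)%N.
    rewrite -mem_outdegree//; apply/idP/idP => [ib|/memE/family_tree_rcons[]//].
    by apply/memE/family_tree_rcons; split=> //; apply/memE.
  apply/eqP; rewrite eqn_leq; apply/andP; split.
    by rewrite leqNgt d ltnn.
  by rewrite leqNgt -d ltnn.
apply/seteqP; split=> v /=.
  elim/last_ind: v => // v i IH /family_tree_rcons[/IH vt ib].
  by rewrite mem_outdegree// -H.
elim/last_ind: v => [_|v i IH vit]; first exact: family_tree_root.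
have vt := par _ _ vit; apply/family_tree_rcons; split; first exact: IH.
by rewrite H// -mem_outdegree.
Qed.

Section BienaymeLaw.
Variables (R : realType) (mu : probability nat R).
Variables (d0 : measure_display) (Omega0 : measurableType d0).
Variables (P0 : probability Omega0 R) (xi : node -> {RV P0 >-> nat}).
Hypothesis xi_iid : iid_offspring xi mu.
Local Notation f := (pmf mu).
Local Notation is_tree t := [set w | bienayme_tree xi w = [set` nodes t]].

Lemma is_treeE (t : plane_tree) :
  is_tree t = \bigcap_(u in [set` nodes t]) (xi u @^-1` [set outdegree (nodes t) u]).
Proof.
apply/seteqP; split=> w /=.
  by move=> /(family_tree_eq _ (plane_treeP t)) H u ut; exact: H.
by move=> H; apply/(family_tree_eq _ (plane_treeP t)) => u ut; exact: H.
Qed.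

Lemma measurable_is_tree (t : plane_tree) : measurable (is_tree t).
Proof.
rewrite is_treeE; apply: fin_bigcap_measurable; first exact: finite_fset.
by move=> u _; rewrite -[X in measurable X]setTI; exact: measurable_funP.
Qed.

Lemma prob_is_tree (t : plane_tree) : P0 (is_tree t) = (tree_weight f (nodes t))%:E.
Proof.
rewrite is_treeE xi_iid.2 -prodEFin; apply: eq_bigr => u _.
by rewrite xi_iid.1 pmfE.
Qed.

(** A finite family tree is a plane tree. *)
Lemma bienayme_sizeE n :
  bienayme_size xi n = \bigcup_(t in [set` trees n]) is_tree t.
Proof.
apply/seteqP; split=> w /=.
  move=> Hn; have fin : finite_set (bienayme_tree xi w) by exists n.
  have /finite_fsetP[X XE] := fin.
  have XU : `[< ulam_harris X >] by apply/asboolP; exact: family_tree_ulam_harris XE.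
  exists (PlaneTree XU) => //=; rewrite mem_trees; apply/eqP/card_eq_fsetP.
  by rewrite -XE.
move=> [t /= tn E]; rewrite /bienayme_size /= E; apply/card_eq_fsetP.
by move: tn; rewrite mem_trees => /eqP.
Qed.

Lemma prob_bienayme_size n :
  P0 (bienayme_size xi n) = (\sum_(t <- trees n) tree_weight f (nodes t))%:E.
Proof.
rewrite bienayme_sizeE measure_fin_bigcup//.
- rewrite -fsbig_seq ?trees_uniq// -sumEFin; apply: eq_bigr => t _.
  exact: prob_is_tree.
- exact: finite_seq.
- move=> s t _ _ [w [/= -> /seteqP[st ts]]]; apply: val_inj; apply/fsetP => v.
  by apply/idP/idP => [/st|/ts].
- by move=> t _; exact: measurable_is_tree.
Qed.

Lemma conditioned_lawE n (t : plane_tree) : #|` nodes t| = n ->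
  conditioned_law xi n t =
  tree_weight f (nodes t) / \sum_(t <- trees n) tree_weight f (nodes t).
Proof.
move=> tn; rewrite /conditioned_law /cond_prob prob_bienayme_size.
rewrite (setIidl _) ?prob_is_tree// bienayme_sizeE => w tw.
by exists t => //=; rewrite mem_trees tn.
Qed.

Variables (n : nat).
Hypothesis n_gt0 : (0 < n)%N.
Hypothesis size_n : (0 < P0 (bienayme_size xi n))%E.

Lemma spine_weight_gt0 : 0 < spine_weight f n 0 n 1.
Proof.
rewrite -trees_total// mulr_gt0 ?ltr0n//.
by move: size_n; rewrite prob_bienayme_size lte_fin.
Qed.

Variables (d : measure_display) (Omega : measurableType d).
Variables (P : probability Omega R) (T : Omega -> plane_tree) (V : Omega -> node).
Hypothesis mTV : measurable_tree_node T V.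
Hypothesis T_law : has_conditioned_law P T n (conditioned_law xi n).
Hypothesis V_unif : uniform_node P T V.

Let Y w : plane_tree * node := (T w, V w).
Let G : seq (plane_tree * node) := [seq (t, v) | t <- trees n, v <- enum_fset (nodes t)].
Let p (y : plane_tree * node) := tree_weight f (nodes y.1) / spine_weight f n 0 n 1.

Let mY y : measurable [set w | Y w = y].
Proof.
rewrite (_ : [set w | _] = [set w | T w = y.1 /\ V w = y.2]); first exact: mTV.
by case: y => t v; apply/seteqP; rewrite /Y; split=> w /= [-> ->].
Qed.

Let uniqG : uniq G.
Proof.
apply: allpairs_uniq_dep => [|t _|[t v] [s u] _ _ /= [-> ->]//].
  exact: trees_uniq.
exact: fset_uniq.
Qed.

Let pP y : y \in G -> P [set w | Y w = y] = (p y)%:E.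
Proof.
move=> /allpairsPdep[t [v [tt vt ->]]]; rewrite mem_trees in tt; have tn := eqP tt.
rewrite (_ : [set w | _] = [set w | T w = t /\ V w = v]); last first.
  by apply/seteqP; rewrite /Y; split=> w /= [-> ->].
rewrite V_unif// T_law// conditioned_lawE// -EFinM /p /= -trees_total// tn.
by rewrite [in RHS]invfM mulrA mulrAC.
Qed.

Let sumG (g : plane_tree * node -> R) :
  \sum_(y <- G) g y * p y = node_mean f n (fun t v => g (t, v)).
Proof.
rewrite big_allpairs_dep /node_mean mulr_suml; apply: eq_bigr => t _.
by rewrite mulr_sumr mulr_suml; apply: eq_bigr => v _; rewrite /p /= mulrCA mulrA.
Qed.

Let p1 : \sum_(y <- G) p y = 1.
Proof.
rewrite -(node_mean_cst n_gt0 spine_weight_gt0 1) -(sumG (fun=> 1)).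
by apply: eq_bigr => y _; rewrite mul1r.
Qed.

Lemma expectation_tree_node (g : plane_tree -> node -> R) : (forall t v, 0 <= g t v) ->
  ('E_P[fun w => g (T w) (V w)] = (node_mean f n g)%:E)%E.
Proof.
move=> g0; rewrite -(sumG (fun y => g y.1 y.2)).
by rewrite -(expectation_discrete mY uniqG pP p1 (g := fun y => g y.1 y.2)).
Qed.

Lemma probability_tree_node (Q : plane_tree -> node -> bool) :
  P [set w | Q (T w) (V w)] = (node_mean f n (fun t v => (Q t v)%:R))%:E.
Proof.
rewrite -(sumG (fun y => (Q y.1 y.2)%:R)).
exact: (probability_discrete mY uniqG pP p1 (fun y => Q y.1 y.2)).
Qed.

End BienaymeLaw.

(** * Convergence in probability and in expectation *)
Lemma cvg_of_near_bounds (R : realType) (F : set_system nat) {FF : Filter F}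
    (u : nat -> \bar R) (c : R) :
  (forall e, 0 < e -> \forall n \near F, ((c - e)%:E <= u n <= (c + e)%:E)%E) ->
  u @ F --> c%:E.
Proof.
move=> H; apply/fine_cvgP; split.
  apply: filterS (H 1 ltr01) => n /andP[lo hi].
  by rewrite fin_real// (lt_le_trans _ lo) ?ltNyr// (le_lt_trans hi) ?ltry.
apply/cvgrPdist_le => e e0; apply: filterS (H e e0) => n /andP[lo hi] /=.
have fu : u n \is a fin_num.
  by rewrite fin_real// (lt_le_trans _ lo) ?ltNyr// (le_lt_trans hi) ?ltry.
move: lo hi; rewrite -(fineK fu) !lee_fin /= distrC ler_distl => -> ->//.
Qed.

Theorem theorem1p3 (R : realType) (mu : probability nat R)
  (mu_subcritical : (moment_norm mu 1 < 1)%E)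
  (mu_heavy : forall t : R, 0 < t ->
    (\sum_(0 <= c <oo) (expR (t * c%:R))%:E * mu [set c] = +oo)%E)
  (d0 : measure_display) (Omega0 : measurableType d0)
  (P0 : probability Omega0 R) (xi : node -> {RV P0 >-> nat})
  (xi_iid : iid_offspring xi mu)
  (d : nat -> measure_display) (Omega : forall n, measurableType (d n))
  (P : forall n, probability (Omega n) R)
  (T : forall n, Omega n -> plane_tree) (V : forall n, Omega n -> node)
  (TV_law : forall n, (0 < P0 (bienayme_size xi n))%E ->
    [/\ measurable_tree_node (T n) (V n),
        has_conditioned_law (P n) (T n) n (conditioned_law xi n) &
        uniform_node (P n) (T n) (V n)]) :
  let F := within [set n | (0 < P0 (bienayme_size xi n))%E] \oo in
  let wid n w := (width (T n w))%:R / Num.sqrt n%:R : R in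
  let dep n w := (size (V n w))%:R / Num.sqrt n%:R : R in
  let ht n w := (height (T n w))%:R / (Num.sqrt n%:R * ln n%:R ^+ 3) : R in
  [/\ to_infty_in_probability F P wid /\ to_infty_in_expectation F P wid,
      to_zero_in_probability F P dep /\ to_zero_in_expectation F P dep &
      to_zero_in_probability F P ht /\ to_zero_in_expectation F P ht].
Proof.
have [m m1 fm] := pmf_mean mu_subcritical.
have f0 := pmf_ge0 mu; have f1 := pmf_mass_le1 mu.
have fB := @pmf_mass1 _ mu; have fH := pmf_heavy mu_heavy.
move=> F wid dep ht.
have FF : Filter F by exact: within_filter.
have near_valid (Q : nat -> Prop) n0 : (forall n, (n0 <= n)%N -> (0 < n)%N ->
    (0 < P0 (bienayme_size xi n))%E -> Q n) -> \forall n \near F, Q n.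
  move=> H; exists (maxn n0 1) => // n /=; rewrite geq_max => /andP[n0n n1] Dn.
  exact: H.
(* Convergence in probability to 0 follows from convergence of the means by Markov's
   inequality. *)
have mean0 (g : nat -> plane_tree -> node -> R) : (forall n t v, 0 <= g n t v) ->
    (forall e, 0 < e -> exists n0, forall n, (n0 <= n)%N -> (0 < n)%N ->
      0 < spine_weight (pmf mu) n 0 n 1 -> node_mean (pmf mu) n (g n) <= e) ->
    to_zero_in_probability F P (fun n w => g n (T n w) (V n w)) /\
    to_zero_in_expectation F P (fun n w => g n (T n w) (V n w)).
  move=> g0 H; split=> [e e0|]; apply: cvg_of_near_bounds => e' e'0; rewrite sub0r add0r.
    have [n0 Hn] := H _ (mulr_gt0 e0 e'0); apply: (near_valid _ n0) => n nn n1 Dn.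
    have w0 := spine_weight_gt0 xi_iid n1 Dn; have [mTV Tl Vu] := TV_law n Dn.
    rewrite (probability_tree_node xi_iid n1 Dn mTV Tl Vu (fun t v => e < `|g n t v|)) !lee_fin.
    apply/andP; split.
      by apply: (@le_trans _ _ 0); [rewrite oppr_le0 ltW | exact: node_mean_ge0].
    rewrite -(ler_pM2l e0); apply: le_trans (Hn n nn n1 w0); rewrite -node_meanZ.
    apply: node_mean_le => // t v _ _; rewrite ger0_norm//.
    by case: ltP => [/ltW|]; rewrite ?mulr1 ?mulr0.
  have [n0 Hn] := H _ e'0; apply: (near_valid _ n0) => n nn n1 Dn.
  have w0 := spine_weight_gt0 xi_iid n1 Dn; have [mTV Tl Vu] := TV_law n Dn.
  rewrite (expectation_tree_node xi_iid n1 Dn mTV Tl Vu (g0 n)) !lee_fin Hn// andbT.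
  by apply: (@le_trans _ _ 0); [rewrite oppr_le0 ltW | exact: node_mean_ge0].
split.
- have likely := fat_likely f0 m1 f1 fm fB fH.
  split=> [K|].
    apply: cvg_of_near_bounds => e e0.
    have [n0 Hn] := likely K e e0; apply: (near_valid _ n0) => n nn n1 Dn.
    have w0 := spine_weight_gt0 xi_iid n1 Dn; have [mTV Tl Vu] := TV_law n Dn.
    rewrite (probability_tree_node xi_iid n1 Dn mTV Tl Vu
      (fun t _ => K <= (width t)%:R / Num.sqrt n%:R)) !lee_fin Hn//=.
    apply: (@le_trans _ _ 1); last by rewrite lerDl ltW.
    rewrite -[leRHS](node_mean_cst n1 w0); apply: node_mean_le => // t v _ _.
    by rewrite lern1 leq_b1.
  apply/cvgeyPge => A; pose K := 2 * Num.max A 0.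
  have K0 : 0 <= K by rewrite mulr_ge0// le_max lexx orbT.
  have h0 : 0 < 2^-1 :> R by rewrite invr_gt0.
  have [n0 Hn] := likely K _ h0; apply: (near_valid _ n0) => n nn n1 Dn.
  have w0 := spine_weight_gt0 xi_iid n1 Dn; have [mTV Tl Vu] := TV_law n Dn.
  rewrite (expectation_tree_node xi_iid n1 Dn mTV Tl Vu
    (g := fun t _ => (width t)%:R / Num.sqrt n%:R)); last by move=> t _; rewrite divr_ge0 ?sqrtr_ge0.
  rewrite lee_fin; apply: (@le_trans _ _ (K * (1 - 2^-1))).
    have : A <= Num.max A 0 by rewrite le_max lexx.
    by rewrite /K; lra.
  apply: le_trans (ler_wpM2l K0 (Hn n nn n1 w0)) _; rewrite -node_meanZ.
  apply: node_mean_le => // t v _ _.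
  have [Kw|_] := leP K ((width t)%:R / Num.sqrt n%:R); rewrite ?mulr1//.
  by rewrite mulr0 divr_ge0 ?sqrtr_ge0.
- apply: (mean0 (fun n _ v => (size v)%:R / Num.sqrt n%:R)).
    by move=> n t v; rewrite divr_ge0 ?sqrtr_ge0.
  exact: (mean_depth_small f0 m1 f1 fm fB fH).
apply: (mean0 (fun n t _ => (height t)%:R / (Num.sqrt n%:R * ln n%:R ^+ 3))).
  move=> [|n] t v; first by rewrite sqrtr0 mul0r invr0 mulr0.
  by rewrite divr_ge0// mulr_ge0 ?sqrtr_ge0// exprn_ge0// ln_ge0// ler1n.
exact: (mean_height_small f0 m1 f1 fm fB fH).
Qed.
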